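(* Let $c_1\ge c_2>0$ and let $\{Y_v\}_{v\in\mathbb N^2}$ be independent exponential random variables with $Y_{(i,j)}\sim \mathrm{Exp}(c_1)$ if $i<j$, $Y_{(i,j)}\sim\mathrm{Exp}(c_1\wedge c_2)$ if $i=j$, and $Y_{(i,j)}\sim\mathrm{Exp}(c_2)$ if $i>j$. For $(m,n)\in\mathbb N^2$ let $$G(m,n)=\max_{\pi\in\Pi(m,n)}\sum_{v\in\pi}Y_v,$$ where $\Pi(m,n)$ is the set of nearest-neighbour paths $(1,1)=v_1,v_2,\dots,v_{m+n-1}=(m,n)$ with $v_{i+1}-v_i\in\{(1,0),(0,1)\}$. Put $c=c_1/c_2\ge 1$ and $b=2c-1-2\sqrt{c(c-1)}$. Then for every $(x,y)\in(0,\infty)^2$ the almost sure limit $\Phi(x,y)=\lim_{n\to\infty}n^{-1}G(\lfloor nx\rfloor,\lfloor ny\rfloor)$ exists and equals $$\Phi(x,y)=\begin{cases} c_1^{-1}(\sqrt x+\sqrt y)^2, & 0<x\le b^2y,\\[3pt] x\,\dfrac{4c-(1+b)^2}{c_1(1-b^2)}+y\,\dfrac{(1+b)^2-4cb^2}{c_1(1-b^2)}, & b^2y<x<y,\\[3pt] c_2^{-1}(\sqrt x+\sqrt y)^2, & y\le x<\infty.\end{cases}$$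
   Context: $\mathrm{Exp}(r)$ denotes the exponential distribution with density $re^{-rx}$ on $(0,\infty)$ (mean $1/r$). $\mathbb N=\{1,2,3,\dots\}$. *)

(* Defs.v *)
From HB Require Import structures.
From mathcomp Require Import all_boot all_order all_algebra.
From mathcomp Require Import all_classical all_reals all_analysis.
Set Implicit Arguments. Unset Strict Implicit. Unset Printing Implicit Defensive.
Import Order.TTheory GRing.Theory Num.Theory.
Import numFieldNormedType.Exports.
Local Open Scope classical_set_scope.
Local Open Scope ring_scope.

Definition site (v : nat * nat) : Prop := (0 < v.1)%N /\ (0 < v.2)%N.

Definition mutually_independent {d} {T : measurableType d} {R : realType}
  (P : probability T R) (I : eqType) (D : set I) (X : I -> {RV P >-> R}) :=
  forall (s : seq I), uniq s -> (forall i, i \in s -> D i) ->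
  forall (A : I -> set R), (forall i, i \in s -> measurable (A i)) ->
  P (\bigcap_(i in [set i | i \in s]) (X i @^-1` A i)) =
  (\prod_(i <- s) P (X i @^-1` A i))%E.

Definition lpp_rate {R : realType} (c1 c2 : R) (v : nat * nat) : R :=
  if (v.1 < v.2)%N then c1 else if v.1 == v.2 then Num.min c1 c2 else c2.

Definition lpp_step (u v : nat * nat) : bool :=
  (v == (u.1.+1, u.2)) || (v == (u.1, u.2.+1)).

Definition lpp_paths (m n : nat) : set (seq (nat * nat)) :=
  [set q | exists p, q = (1, 1)%N :: p /\
     path lpp_step (1, 1)%N p /\ last (1, 1)%N p = (m, n)].

Definition lpp_G {d} {T : measurableType d} {R : realType}
  (P : probability T R) (Y : nat * nat -> {RV P >-> R}) (m n : nat) (w : T) : R :=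
  sup [set (\sum_(v <- q) Y v w) | q in lpp_paths m n].

Definition lpp_b {R : realType} (c1 c2 : R) : R :=
  let c := c1 / c2 in 2 * c - 1 - 2 * Num.sqrt (c * (c - 1)).

Definition lpp_Phi {R : realType} (c1 c2 x y : R) : R :=
  let c := c1 / c2 in let b := lpp_b c1 c2 in
  if x <= b ^+ 2 * y then c1^-1 * (Num.sqrt x + Num.sqrt y) ^+ 2
  else if x < y then
    x * ((4 * c - (1 + b) ^+ 2) / (c1 * (1 - b ^+ 2))) +
    y * (((1 + b) ^+ 2 - 4 * c * b ^+ 2) / (c1 * (1 - b ^+ 2)))
  else c2^-1 * (Num.sqrt x + Num.sqrt y) ^+ 2.

(* Main.v *)
(* Last-passage times with iid Exp(1) weights X are compared with those of a stationary
   model, obtained by dividing the weights by al on the first row and by 1 - al on the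
   first column.  Burke's property makes the increments of the stationary passage time
   along every column independent exponentials, so a Chernoff bound and Borel-Cantelli
   show that almost surely it is close to a/al + b/(1 - al) uniformly over all boxes of
   linear size.  This dominates the passage time for X.  For the matching lower bound,
   take the al that minimizes a/al + b/(1 - al): perturbing al shows that the optimal
   path of the stationary model spends little on the boundary.

   The weights of the theorem are X/c1 above the diagonal and X/c2 on and below it.  For
   x < y, cutting an optimal path at its last visit (k, k) to the diagonal bounds G by
   4k/c2 + ((m - k)/al + (n - k)/(1 - al))/c1, which is at most (m/al + n/(1 - al))/c1 as
   soon as 4c <= 1/(al(1 - al)).  Since (1 + b)^2 = 4cb, the extreme admissible value is
   al = b/(1 + b), and it gives the linear regime.  The lower bounds come from chains of
   blocks close to the diagonal, followed by one block of slope b^2. *)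
Require Import Defs.
From HB Require Import structures.
From mathcomp Require Import all_boot all_order all_algebra.
From mathcomp Require Import all_classical all_reals all_analysis.
From mathcomp Require Import measurable_realfun zify ring lra.
Set Implicit Arguments. Unset Strict Implicit. Unset Printing Implicit Defensive.
Import Order.TTheory GRing.Theory Num.Theory.
Import numFieldNormedType.Exports.
Local Open Scope classical_set_scope.
Local Open Scope ring_scope.

(** Stationarity asks the two boundary rates to add up to the bulk rate 1, whence [al] and [1 - al].
    The perturbation argument compares two orders of magnitude. For a box with sides proportional to
    [al^2] and [(1 - al)^2], moving the parameter by [eta] away from its minimizer raises the
    centring only by order [eta^2 n], while a boundary share S of the optimal path is raised by at
    least [eta * S]; hence S is of order [eta * n]. Two kinds of uniformity shape the statements.
    Blocks are placed at positions that grow with [n], so the estimates must hold for all shifted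
    boxes at once: the Chernoff bound is exponential in [n] and there are only polynomially many
    boxes. The parameters vary too, but only by the countably many steps [1/(k+1)]. In the two-rate
    model a diagonal step (1, 1) is worth 4/c2, and the linear functional attached to [al] prices it
    at (1/al + 1/(1 - al))/c1; the condition on 4c compares these two prices. At al = b/(1 + b) the
    direction (al^2, (1 - al)^2) is that of (b^2, 1), which is why the linear regime starts at x =
    b^2 y. *)

(** * Uniqueness of measures and the exponential law *)

Lemma eq_measure_rays (R : realType) (m1 m2 : {measure set R -> \bar R}) :
  (m1 setT < +oo)%E -> (forall t : R, m1 `]t, +oo[%classic = m2 `]t, +oo[%classic) ->
  forall A, measurable A -> m1 A = m2 A.
Proof.
move=> m1oo m12 A mA.
apply: (measure_unique (@RGenOInfty.G R) (fun n : nat => `](- n%:R), +oo[%classic)) => //.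
- exact: RGenOInfty.measurableE.
- move=> _ _ [x ->] [y ->]; exists (Num.max x y).
  by apply/seteqP; split => z /=; rewrite !in_itv /= !andbT gt_max => /andP.
- by move=> i; exists (- i%:R).
- apply/seteqP; split=> // x _; exists (Num.truncn (- x)).+1 => //=.
  by rewrite in_itv /= andbT ltrNl truncnS_gt.
- by move=> _ [t ->].
- move=> k; apply: le_lt_trans m1oo.
  by apply: le_measure; rewrite ?inE.
Qed.

Lemma eq_measure_rect d1 d2 (T1 : measurableType d1) (T2 : measurableType d2)
    (R : realType) (m1 m2 : {measure set (T1 * T2) -> \bar R}) :
  (m1 setT < +oo)%E ->
  (forall A B, measurable A -> measurable B -> m1 (A `*` B) = m2 (A `*` B)) ->
  forall D, measurable D -> m1 D = m2 D.
Proof.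
move=> m1oo m12 D mD.
pose C : set (set (T1 * T2)) :=
  [set C | exists A, measurable A /\ exists B, measurable B /\ C = A `*` B].
apply: (measure_unique C (fun n : nat => setT)) => //.
- rewrite measurable_prod_measurableType //; congr (<<s _ >>).
  rewrite predeqE; split => [[A mA [B mB <-]]|[A [mA [B [mB ->]]]]].
    by exists A; split => //; exists B.
  by exists A => //; exists B.
- move=> /= _ _ [X1 [mX1 [X2 [mX2 ->]]]] [Y1 [mY1 [Y2 [mY2 ->]]]].
  rewrite -setXI; exists (X1 `&` Y1); split; first exact: measurableI.
  by exists (X2 `&` Y2); split => //; exact: measurableI.
- by move=> i; exists setT; split => //; exists setT; split => //; rewrite setXTT.
- by apply/seteqP; split => // x _; exists 0%N.
- by move=> _ [A [mA [B [mB ->]]]]; exact: m12.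
Qed.

(** The event [E] of weight [c] stands for a conditioning: on the other members of a family, or on a
    minimum exceeding [t]. A full [E] with [c = 1] gives plain independence. *)
Lemma pair_law d d1 d2 (T : measurableType d) (T1 : measurableType d1)
    (T2 : measurableType d2) (R : realType) (P : probability T R)
    (X : T -> T1) (Y : T -> T2) (E : set T)
    (m1 : probability T1 R) (m2 : probability T2 R) (c : R) :
  measurable_fun setT X -> measurable_fun setT Y -> measurable E -> 0 <= c ->
  (forall A B, measurable A -> measurable B ->
     P (E `&` (X @^-1` A `&` Y @^-1` B)) = (c%:E * (m1 A * m2 B))%E) ->
  forall D, measurable D ->
    P (E `&` [set w | D (X w, Y w)]) = (c%:E * (m1 \x m2)%E D)%E.
Proof.
move=> mX mY mE c0 h D mD.
have mXY : measurable_fun setT (fun w => (X w, Y w)) by exact: measurable_fun_pair.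
pose mu0 : {measure set (T1 * T2) -> \bar R} :=
  pushforward (mrestr P mE) (fun w => (X w, Y w)).
pose mu1 := mu0 mXY.
pose mu2 : {measure set (T1 * T2) -> \bar R} := mscale (NngNum c0) (m1 \x m2)%E.
have mu12 : forall A B, measurable A -> measurable B ->
    mu1 (A `*` B) = mu2 (A `*` B).
  move=> A B mA mB; rewrite /mu1 /mu0 /mu2 /= /pushforward /mrestr /mscale /=.
  rewrite product_measure1E//= -h//; congr (P _).
  by apply/seteqP; split => w /= => [[[? ?] ?]|[? [? ?]]].
have fin : (mu1 setT < +oo)%E.
  rewrite /mu1 /mu0 /= /pushforward /mrestr /=.
  by rewrite (le_lt_trans (probability_le1 _ _)) ?ltry// preimage_setT setTI.
have := eq_measure_rect fin mu12 mD.
rewrite /mu1 /mu0 /mu2 /= /pushforward /mrestr /mscale /= => <-.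
by rewrite setIC.
Qed.

(* Total in [r], so that it can be used without carrying positivity proofs:
   the point mass at 0 when [r <= 0]. *)
Definition elaw (R : realType) (r : R) : set R -> \bar R :=
  if 0 < r then exponential_prob r else \d_(0 : R).

Local Notation exponential_measure :=
  exponential_distribution_exponential_prob__canonical__measure_function_Measure.

Lemma elaw0 (R : realType) (r : R) : elaw r set0 = 0%E.
Proof.
rewrite /elaw; case: ifP => r0; last exact: measure0.
exact: (@measure0 _ _ _ (exponential_measure r0)).
Qed.

Lemma elaw_ge0 (R : realType) (r : R) A : (0 <= elaw r A)%E.
Proof.
rewrite /elaw; case: ifP => r0; last exact: measure_ge0.
exact: (@measure_ge0 _ _ _ (exponential_measure r0)).
Qed.

Lemma elaw_semi_sigma_additive (R : realType) (r : R) : semi_sigma_additive (elaw r).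
Proof.
rewrite /elaw; case: ifP => r0; last exact: measure_semi_sigma_additive.
exact: (@measure_semi_sigma_additive _ _ _ (exponential_measure r0)).
Qed.

HB.instance Definition _ (R : realType) (r : R) := isMeasure.Build _ _ R (elaw r)
  (elaw0 r) (elaw_ge0 r) (@elaw_semi_sigma_additive R r).

Lemma elaw_setT (R : realType) (r : R) : elaw r setT = 1%E.
Proof.
rewrite /elaw; case: ifP => r0; last by rewrite diracT.
exact: integral_exponential_pdf.
Qed.

HB.instance Definition _ (R : realType) (r : R) :=
  Measure_isProbability.Build _ _ R (elaw r) (elaw_setT r).

Lemma elawE (R : realType) (r : R) (A : set R) : 0 < r ->
  elaw r A = exponential_prob r A.
Proof. by rewrite /elaw => ->. Qed.

Lemma elaw_le (R : realType) (r t : R) : 0 < r -> 0 <= t ->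
  elaw r `]-oo, t]%classic = (1 - (expR (- r * t))%:E)%E.
Proof.
move=> r0 t0.
have -> : `]-oo, t]%classic = `]-oo, 0%R[%classic `|` `[0%R, t]%classic.
  apply/seteqP; split => x /=; rewrite !in_itv /=.
    by move=> ->; rewrite andbT; case: (ltP x 0) => ?; [left|right].
  by case=> [/ltW/le_trans->//|/andP[]].
have -> : elaw r (`]-oo, 0%R[%classic `|` `[0%R, t]%classic) =
    (elaw r `]-oo, 0%R[%classic + elaw r `[0%R, t]%classic)%E.
  apply: measureU => //.
  by apply/seteqP; split => x //= []; rewrite !in_itv /= => ? /andP[]; lra.
rewrite !elawE// [X in (X + _)%E]/exponential_prob integral0_eq ?add0e; last first.
  by move=> x /=; rewrite in_itv /= => x0; rewrite lt0_exponential_pdf.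
have [->|tn0] := eqVneq t 0.
  rewrite mulr0 expR0 subee// set_itv1 /exponential_prob integral_set1//.
by rewrite exponential_prob_itv0c// lt_neqAle eq_sym tn0.
Qed.

Lemma elaw_gt (R : realType) (r t : R) : 0 < r ->
  elaw r `]t, +oo[%classic = (expR (- r * Num.max t 0))%:E.
Proof.
move=> r0.
have gt0E s : 0 <= s -> elaw r `]s, +oo[%classic = (expR (- r * s))%:E.
  move=> s0; rewrite -setCitvl (@probability_setC _ _ _ (elaw r))//= elaw_le//.
  by rewrite -[1%E]/(1%:E) -!EFinB; congr EFin; ring.
have [t0|t0] := leP 0 t; first by rewrite gt0E.
rewrite mulr0 expR0; apply/eqP; rewrite eq_le probability_le1//=.
have <- : elaw r `]0%R, +oo[%classic = 1%:E by rewrite gt0E// mulr0 expR0.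
apply: le_measure; rewrite ?inE//.
by move=> x /=; rewrite !in_itv /= !andbT; lra.
Qed.

(** Memorylessness for general sets: both sides are finite measures in [A], and on rays the identity
    is the functional equation of [expR]. *)
Lemma elaw_shift (R : realType) (r t : R) (A : set R) : 0 < r -> 0 <= t ->
  measurable A ->
  elaw r (A `&` `]t, +oo[%classic) =
  ((expR (- r * t))%:E * elaw r [set x | A (x + t)%R])%E.
Proof.
move=> r0 t0 mA.
have mt : measurable_fun setT (shift t : R -> R).
  exact: measurable_funD.
pose m1 : {measure set R -> \bar R} :=
  mrestr (elaw r) (measurable_itv `]t, +oo[).
pose m0 : {measure set R -> \bar R} :=
  pushforward (elaw r) (shift t : R -> R).
pose m2 : {measure set R -> \bar R} :=
  mscale (NngNum (expR_ge0 (- r * t))) (m0 mt).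
have : m1 A = m2 A.
  apply: eq_measure_rays => //.
    by rewrite /m1 /= /mrestr (le_lt_trans (probability_le1 _ _)) ?ltry// setTI.
  move=> s; rewrite /m1 /m2 /m0 /= /mrestr /mscale /= /pushforward.
  have -> : `]s, +oo[%classic `&` `]t, +oo[%classic = `](Num.max s t), +oo[%classic.
    by apply/seteqP; split => z /=; rewrite !in_itv /= !andbT gt_max => /andP.
  have -> : (shift t : R -> R) @^-1`
      `]s, +oo[%classic = `](s - t), +oo[%classic.
    by apply/seteqP; split => z /=; rewrite !in_itv /= !andbT; lra.
  rewrite !elaw_gt// -EFinM -expRD; congr (expR _)%:E.
  rewrite -mulrDr; congr (_ * _).
  by rewrite !maxEle; repeat case: ifP; lra.
by [].
Qed.

(** The change of variables is known for the Radon-Nikodym derivative, and [g] equals it almost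
    everywhere because both have the same integral over every measurable set. *)
Lemma ge0_integral_density d (T : measurableType d) (R : realType)
    (nu : {finite_measure set T -> \bar R})
    (mu : {sigma_finite_measure set T -> \bar R}) (g f : T -> \bar R) :
  measurable_fun setT g -> (forall x, 0 <= g x)%E ->
  (forall A, measurable A -> nu A = \int[mu]_(x in A) g x)%E ->
  measurable_fun setT f -> (forall x, 0 <= f x)%E ->
  (\int[nu]_x f x = \int[mu]_x (f x * g x))%E.
Proof.
move=> mg g0 nuE mf f0.
have numu : nu `<< mu.
  apply/null_content_dominatesP => A mA muA0.
  rewrite nuE//; apply: null_set_integral => //; exact: measurable_funTS.
rewrite -(Radon_Nikodym_SigmaFinite.change_of_variables numu)//.
have fi := Radon_Nikodym_SigmaFinite.f_integrable numu.
apply: ae_eq_integral => //.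
- by apply: emeasurable_funM => //; exact: measurable_int fi.
- exact: emeasurable_funM.
- apply: ae_eqe_mul2l; apply: integral_ae_eq => //.
  move=> E _ mE; rewrite -nuE//.
  by rewrite (Radon_Nikodym_SigmaFinite.f_integral numu).
Qed.

(** Tilting stays within the exponential densities, so the moment generating function reduces to a
    total mass. *)
Lemma exponential_pdf_tilt (R : realType) (r t x : R) : t < r ->
  expR (t * x) * exponential_pdf r x = r / (r - t) * exponential_pdf (r - t) x.
Proof.
move=> tr; have [x0|x0] := ltP x 0; first by rewrite !lt0_exponential_pdf// !mulr0.
rewrite !exponential_pdfE// [in RHS]mulrA divfK ?subr_eq0 ?gt_eqF//.
by rewrite mulrCA -expRD; congr (_ * expR _); ring.
Qed.

Lemma exp_mgf d (T : measurableType d) (R : realType) (P : probability T R)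
    (X : T -> R) (r t : R) : 0 < r -> t < r -> measurable_fun setT X ->
  (forall A, measurable A -> P (X @^-1` A) = elaw r A) ->
  (\int[P]_w (expR (t * X w))%:E = (r / (r - t))%:E)%E.
Proof.
move=> r0 tr mX PX.
have rt0 : 0 < r - t by rewrite subr_gt0.
pose m0 : probability (measurableTypeR R) R :=
  exponential_distribution_exponential_prob__canonical__probability_measure_Probability r0.
have mexp : measurable_fun setT (fun x : measurableTypeR R => (expR (t * x))%:E).
  apply/measurable_EFinP; apply: measurableT_comp => //; exact: measurable_funM.
transitivity (\int[m0]_x (expR (t * x))%:E)%E.
  pose X' : T -> measurableTypeR R := X.
  have mX' : measurable_fun setT X' by [].
  pose m1 : {measure set (measurableTypeR R) -> \bar R} := pushforward P X'.
  have <- : (\int[m1 mX']_x (expR (t * x))%:E = \int[P]_w (expR (t * X w))%:E)%E.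
    by rewrite ge0_integral_pushforward ?preimage_setT.
  apply: eq_measure_integral => A mA _.
  by rewrite /= /pushforward PX// elawE.
rewrite (ge0_integral_density (mu := lebesgue_measure)
    (g := fun x => (exponential_pdf r x)%:E))//; first last.
- by move=> x; rewrite lee_fin exponential_pdf_ge0// ltW.
- by apply/measurable_EFinP; exact: measurable_exponential_pdf.
under eq_integral do rewrite -EFinM exponential_pdf_tilt// EFinM.
rewrite ge0_integralZl//=.
- by rewrite integral_exponential_pdf// mule1.
- by apply/measurable_EFinP; exact: measurable_exponential_pdf.
- by move=> x _; rewrite lee_fin exponential_pdf_ge0// ltW.
- by rewrite lee_fin divr_ge0// ltW.
Qed.

(** The law charges only the positive half-line, so the positive part leaves it unchanged; it yields
    weights that are nonnegative at every sample point rather than almost surely. *)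
Lemma elaw_posscale (R : realType) (r k : R) (A : set R) : 0 < r -> 0 < k ->
  measurable A ->
  elaw r [set x | A (k * Num.max x 0)] = elaw (r / k) A.
Proof.
move=> r0 k0 mA.
pose f (x : R) : R := k * Num.max x 0.
have mf : measurable_fun setT f.
  by apply: measurable_funM => //; exact: measurable_maxr.
pose m1 : {measure set R -> \bar R} := pushforward (elaw r) f.
have : m1 mf A = elaw (r / k) A.
  apply: eq_measure_rays => //.
    by rewrite (le_lt_trans (probability_le1 (elaw r) _)) ?ltry// preimage_setT.
  move=> s; rewrite /m1 /= /pushforward elaw_gt ?divr_gt0//.
  have [s0|s0] := leP 0 s.
    have -> : f @^-1` `]s, +oo[%classic =
        `](s / k), +oo[%classic.
      apply/seteqP; split => x /=; rewrite /f !in_itv /= !andbT ltr_pdivrMr// mulrC.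
        have [//|x0] := leP 0 x; rewrite mul0r => /(le_lt_trans s0).
        by rewrite ltxx.
      move=> sx; have x0 : 0 < x by rewrite -(pmulr_rgt0 _ k0) (le_lt_trans s0).
      by rewrite max_l// ltW.
    rewrite elaw_gt// max_l ?divr_ge0// ?ltW//; congr (expR _)%:E; field.
    exact: lt0r_neq0.
  rewrite (_ : _ @^-1` _ = setT) ?elaw_setT ?mulr0 ?expR0//.
  apply/seteqP; split => x //= _; rewrite /f in_itv /= andbT (lt_le_trans s0)//.
  by rewrite mulr_ge0 ?(ltW k0)// le_max lexx orbT.
by [].
Qed.

(** * Burke's property for three exponential variables *)

Lemma measurable_preimageT d d' (T : measurableType d) (T' : measurableType d')
    (f : T -> T') (A : set T') :
  measurable_fun setT f -> measurable A -> measurable (f @^-1` A).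
Proof. by move=> mf mA; rewrite -[X in measurable X]setTI; exact: mf. Qed.

Lemma measurable_diff (R : realType) :
  measurable_fun setT (fun z : R * R => z.1 - z.2).
Proof. by apply: measurable_funB; [exact: measurable_fst|exact: measurable_snd]. Qed.

Lemma measurable_min2 (R : realType) :
  measurable_fun setT (fun z : R * R => Num.min z.1 z.2).
Proof. by apply: measurable_minr; [exact: measurable_fst|exact: measurable_snd]. Qed.

(** Subtracting [t] from both coordinates preserves their difference, so the memorylessness of each
    coordinate passes to the pair. *)
Lemma elaw_pair_memoryless (R : realType) (a b t : R) (A : set R) :
  0 < a -> 0 < b -> 0 <= t -> measurable A ->
  (elaw a \x elaw b)%E ([set z | t < Num.min z.1 z.2] `&` [set z | A (z.1 - z.2)]) =
  ((expR (- (a + b) * t))%:E * (elaw a \x elaw b)%E [set z | A (z.1 - z.2)%R])%E.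
Proof.
move=> a0 b0 t0 mA.
have mt : measurable_fun setT (fun x : R => x - t) by exact: measurable_funB.
have mX : measurable_fun setT (fun z : R * R => z.1 - t).
  by apply: measurable_funB => //; exact: measurable_fst.
have mY : measurable_fun setT (fun z : R * R => z.2 - t).
  by apply: measurable_funB => //; exact: measurable_snd.
have mE : measurable [set z : R * R | t < Num.min z.1 z.2].
  have := measurable_preimageT (@measurable_min2 R) (measurable_itv `]t, +oo[).
  by congr measurable; apply/seteqP; split => z /=; rewrite in_itv /= andbT.
have mD : measurable [set z : R * R | A (z.1 - z.2)].
  exact: (measurable_preimageT (@measurable_diff R) mA).
have := @pair_law _ _ _ (R * R)%type R R R [the probability _ R of (elaw a \x elaw b)%E]
  _ _ _ (elaw a) (elaw b) (expR (- (a + b) * t)) mX mY mE (expR_ge0 _) _ _ mD.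
rewrite /= => <-.
  congr ((_ \x _)%E _); apply/seteqP; split => z /= [? zA]; split=> //.
    by rewrite opprB addrA subrK.
  by move: zA; rewrite opprB addrA subrK.
move=> B C mB mC.
rewrite (_ : _ `&` _ =
    ((fun x : R => x - t) @^-1` B `&` `]t, +oo[%classic) `*`
    ((fun x : R => x - t) @^-1` C `&` `]t, +oo[%classic)); last first.
  apply/seteqP; split => z /=; rewrite !in_itv /= !andbT lt_min.
    by move=> [/andP[? ?] [? ?]].
  by move=> [[? ?] [? ?]]; split => //; apply/andP.
have shiftE (r : R) (D : set R) : 0 < r -> measurable D ->
  elaw r ((fun x : R => x - t) @^-1` D `&` `]t, +oo[%classic) =
    ((expR (- r * t))%:E * elaw r D)%E.
  move=> r0 mD'; rewrite elaw_shift//; last exact: measurable_preimageT.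
  by congr (_ * elaw r _)%E; apply/seteqP; split => x /=; rewrite addrK.
rewrite product_measure1E/=; first last.
- by apply: measurableI => //; exact: measurable_preimageT.
- by apply: measurableI => //; exact: measurable_preimageT.
rewrite !shiftE// muleACA -EFinM -expRD; congr ((expR _)%:E * _)%E; ring.
Qed.

Lemma elaw_pair_pos (R : realType) (a b : R) (A : set R) : 0 < a -> 0 < b ->
  measurable A ->
  (elaw a \x elaw b)%E ([set z | 0 < Num.min z.1 z.2] `&` [set z | A (z.1 - z.2)]) =
  (elaw a \x elaw b)%E [set z | A (z.1 - z.2)%R].
Proof.
by move=> a0 b0 mA; rewrite elaw_pair_memoryless// mulr0 expR0 mul1e.
Qed.

(** For fixed [A] both sides are finite measures in [B]. On the ray above [t >= 0] they agree by
    memorylessness, and for [t < 0] because the minimum is almost surely positive. *)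
Lemma elaw_diff_min (R : realType) (a b : R) (A B : set R) : 0 < a -> 0 < b ->
  measurable A -> measurable B ->
  (elaw a \x elaw b)%E ([set z | B (Num.min z.1 z.2)] `&` [set z | A (z.1 - z.2)]) =
  ((elaw a \x elaw b)%E [set z | A (z.1 - z.2)%R] * elaw (a + b) B)%E.
Proof.
move=> a0 b0 mA mB.
pose mu : probability (R * R)%type R := [the probability _ R of (elaw a \x elaw b)%E].
have mD : measurable [set z : R * R | A (z.1 - z.2)].
  exact: (measurable_preimageT (@measurable_diff R) mA).
have fD : mu [set z : R * R | A (z.1 - z.2)] \is a fin_num by exact: fin_num_measure.
have c0 : 0 <= fine (mu [set z : R * R | A (z.1 - z.2)]) by exact: fine_ge0.
pose mn (z : R * R) : R := Num.min z.1 z.2.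
have mmn : measurable_fun setT mn by exact: measurable_min2.
pose m1f : {measure set R -> \bar R} := pushforward (mrestr mu mD) mn.
pose m2 : {measure set R -> \bar R} := mscale (NngNum c0) (elaw (a + b)).
have : m1f mmn B = m2 B.
  apply: eq_measure_rays => //.
    rewrite /m1f /= /pushforward /mrestr /= preimage_setT setTI.
    by rewrite (le_lt_trans (probability_le1 mu _)) ?ltry.
  move=> t; rewrite /m1f /m2 /= /pushforward /mrestr /mscale /=.
  rewrite fineK// elaw_gt ?addr_gt0//.
  have gtE s : mn @^-1` `]s, +oo[%classic = [set z | s < Num.min z.1 z.2].
    by apply/seteqP; split => z /=; rewrite in_itv /= andbT.
  have mgt s : measurable [set z : R * R | s < Num.min z.1 z.2].
    by rewrite -gtE; exact: measurable_preimageT.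
  rewrite gtE; have [t0|t0] := leP 0 t.
    by rewrite elaw_pair_memoryless// muleC.
  rewrite mulr0 expR0 mule1; apply/eqP; rewrite eq_le; apply/andP; split.
    by apply: (@le_measure _ _ _ mu); rewrite ?inE//; exact: measurableI.
  rewrite -[X in (X <= _)%E]elaw_pair_pos//.
  apply: (@le_measure _ _ _ mu); rewrite ?inE//; try exact: measurableI.
  by move=> z /= [? ?]; split=> //; lra.
by rewrite /m1f /m2 /= /pushforward /mrestr /mscale /= fineK.
Qed.

(* The pairs [(U - V, w)] and [(U - V, min U V)] have the same law, and the map
   of the statement sends the second one to [(U, V)]. *)
Lemma burke_law (R : realType) (a b : R) (A B : set R) : 0 < a -> 0 < b ->
  measurable A -> measurable B ->
  (elaw a \x elaw b \x elaw (a + b))%E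
    [set z | A (Num.max (z.1.1 - z.1.2) 0 + z.2) /\
             B (Num.max (z.1.2 - z.1.1) 0 + z.2)] =
  (elaw a A * elaw b B)%E.
Proof.
move=> a0 b0 mA mB.
pose mu : probability (R * R)%type R := [the probability _ R of (elaw a \x elaw b)%E].
pose df (z : R * R) : R := z.1 - z.2.
have mdf : measurable_fun setT df by exact: measurable_diff.
pose X : {mfun (R * R)%type >-> R} := mfun_Sub (mem_set mdf).
pose m1 : probability R R := [the probability R R of distribution mu X].
pose D := [set y : R * R | A (Num.max y.1 0 + y.2) /\ B (Num.max (- y.1) 0 + y.2)].
have mD : measurable D.
  apply: measurableI.
    apply: (@measurable_preimageT _ _ _ _ (fun y : R * R => Num.max y.1 0 + y.2)) mA.
    apply: measurable_funD; last exact: measurable_snd.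
    by apply: measurable_maxr => //; exact: measurable_fst.
  apply: (@measurable_preimageT _ _ _ _ (fun y : R * R => Num.max (- y.1) 0 + y.2)) mB.
  apply: measurable_funD; last exact: measurable_snd.
  by apply: measurable_maxr => //; apply: measurable_funN; exact: measurable_fst.
have L1 := @pair_law _ _ _ (R * R)%type R R R mu df (fun z => Num.min z.1 z.2) setT
  m1 (elaw (a + b)) 1 mdf (@measurable_min2 R) measurableT ler01 _ D mD.
have mdf1 : measurable_fun setT (fun z : R * R * R => df z.1).
  by apply: measurableT_comp => //; exact: measurable_fst.
have L2 := @pair_law _ _ _ (R * R * R)%type R R R
  [the probability _ R of (elaw a \x elaw b \x elaw (a + b))%E]
  (fun z => df z.1) snd setT m1 (elaw (a + b)) 1 mdf1 measurable_snd measurableT ler01 _ D mD.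
transitivity ((m1 \x elaw (a + b))%E D).
  rewrite -[RHS]mul1e -L2.
    congr ((_ \x _)%E _); rewrite setTI; apply/seteqP.
    by split => z; rewrite /D /df /= opprB.
  move=> A' B' mA' mB'; rewrite mul1e setTI.
  have := @product_measure1E _ _ _ _ R mu (elaw (a + b)) (df @^-1` A') B'
    (measurable_preimageT mdf mA') mB'.
  by move=> <-; congr ((_ \x _)%E _); apply/seteqP; split.
rewrite -[LHS]mul1e -L1.
  rewrite -product_measure1E// setTI; congr ((_ \x _)%E _); apply/seteqP.
  split => z; rewrite /D /df /= opprB => -[zA zB].
    split.
      move: zA; congr A; rewrite minElt maxElt; case: ifP; case: ifP; lra.
    move: zB; congr B; rewrite minElt maxElt; case: ifP; case: ifP; lra.
  split.
    move: zA; congr A; rewrite minElt maxElt; case: ifP; case: ifP; lra.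
  move: zB; congr B; rewrite minElt maxElt; case: ifP; case: ifP; lra.
move=> A' B' mA' mB'; rewrite mul1e setTI setIC.
by have := elaw_diff_min a0 b0 mA' mB'.
Qed.

(** * Families of independent exponentials and the Burke move *)

(** Independence and the marginal laws are packed into one product formula; one-element lists
    recover the law of each [Z i]. The domain [D] may shrink, which lets every Burke move give up
    one index. *)
Definition elaw_family d (T : measurableType d) (R : realType) (P : probability T R)
    (I : eqType) (D : set I) (r : I -> R) (Z : I -> T -> R) : Prop :=
  [/\ forall i, D i -> 0 < r i,
      forall i, D i -> measurable_fun setT (Z i) &
      forall (s : seq I) (A : I -> set R), uniq s -> (forall i, i \in s -> D i) ->
        (forall i, measurable (A i)) ->
        P [set w | forall i, i \in s -> A i (Z i w)] =
        (\prod_(i <- s) elaw (r i) (A i))%E].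

Lemma forall_in_cons (I : eqType) (i : I) (s : seq I) (Q : I -> Prop) :
  (forall j, j \in i :: s -> Q j) <-> Q i /\ (forall j, j \in s -> Q j).
Proof.
split=> [h|[Qi h] j]; first by split=> [|j js]; apply: h; rewrite in_cons ?eqxx// js orbT.
by rewrite in_cons => /orP[/eqP->|/h].
Qed.

Lemma prod_elaw_fin_num (R : realType) (I : Type) (r : I -> R) (s : seq I)
    (A : I -> set R) : (forall i, measurable (A i)) ->
  (\prod_(i <- s) elaw (r i) (A i))%E \is a fin_num.
Proof.
move=> mA; elim: s => [|i s ih]; first by rewrite big_nil.
by rewrite big_cons fin_numM//; exact: fin_num_measure.
Qed.

Lemma prod_elaw_ge0 (R : realType) (I : Type) (r : I -> R) (s : seq I)
    (A : I -> set R) : (0 <= \prod_(i <- s) elaw (r i) (A i))%E.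
Proof.
elim: s => [|i s ih]; first by rewrite big_nil.
by rewrite big_cons mule_ge0.
Qed.

Lemma elaw_family_law d (T : measurableType d) (R : realType) (P : probability T R)
    (I : eqType) (D : set I) (r : I -> R) (Z : I -> T -> R) (i : I) (A : set R) :
  elaw_family P D r Z -> D i -> measurable A -> P (Z i @^-1` A) = elaw (r i) A.
Proof.
move=> [_ _ h] Di mA; have := h [:: i] (fun=> A) isT.
rewrite big_seq1 => <-//; last by move=> j; rewrite inE => /eqP->.
congr (P _); apply/seteqP; split=> w /=; first by move=> ? j; rewrite inE => /eqP->.
by apply; rewrite inE.
Qed.

Lemma measurable_family_event d (T : measurableType d) (R : realType)
    (I : eqType) (Z : I -> T -> R) (s : seq I) (A : I -> set R) :
  (forall i, i \in s -> measurable_fun setT (Z i)) -> (forall i, measurable (A i)) ->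
  measurable [set w | forall i, i \in s -> A i (Z i w)].
Proof.
move=> mZ mA; elim: s mZ => [|i s ih] mZ.
  by rewrite (_ : mkset _ = setT)//; apply/seteqP; split.
rewrite (_ : mkset _ = Z i @^-1` A i `&` [set w | forall i, i \in s -> A i (Z i w)]).
  apply: measurableI; first by apply: measurable_preimageT => //; apply: mZ; rewrite mem_head.
  by apply: ih => j js; apply: mZ; rewrite in_cons js orbT.
by apply/seteqP; split=> w /=; rewrite forall_in_cons.
Qed.

(* Padding by the full sets reduces the product rule to index lists containing
   two prescribed indices. *)
Lemma family_pad (R : realType) (I : eqType) (r : I -> R) (s : seq I) (A : I -> set R)
    (i j : I) : uniq s -> i != j ->
  let A' k := if k \in s then A k else setT in
  let s0 := [seq k <- s | (k != i) && (k != j)] in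
  (\prod_(k <- s) elaw (r k) (A k) =
   elaw (r i) (A' i) * (elaw (r j) (A' j) * \prod_(k <- s0) elaw (r k) (A' k)))%E.
Proof.
move=> us ij A' s0.
have us' : uniq [:: i, j & s0].
  rewrite /= !inE negb_or ij !mem_filter eqxx /= eqxx andbF /=; exact: filter_uniq.
have E k : (if k \in s then elaw (r k) (A' k) else 1)%E = elaw (r k) (A' k).
  by rewrite /A'; case: (k \in s) => //=; rewrite elaw_setT.
have sub k : k \in s -> k \in [:: i, j & s0].
  by rewrite !inE mem_filter => ->; case: eqP => //=; case: eqP.
transitivity (\prod_(k <- [:: i, j & s0] | k \in s) elaw (r k) (A' k))%E; last first.
  rewrite big_mkcond /= !big_cons !E.
  by under eq_bigr do rewrite E.
move: us' sub; set s' := (_ :: _) => us' sub.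
have pm : perm_eq s [seq k <- s' | k \in s].
  apply: uniq_perm => //; first exact: filter_uniq.
  by move=> k; rewrite mem_filter; case: (boolP (k \in s)) => // /sub ->.
rewrite -[RHS]big_filter -(perm_big _ pm).
rewrite -[RHS]/(\prod_(k <- s) elaw (r k) (A' k))%E.
by apply: eq_big_seq => k ks; rewrite /A' ks.
Qed.

(** The local Burke move at a cell: [i] and [j] carry the increments entering it and are overwritten
    by those leaving it; [k] carries the weight of the cell. *)
Definition flip (R : realType) (T : Type) (I : eqType) (Z : I -> T -> R) (i j k : I)
    (m : I) (w : T) : R :=
  if m == i then Num.max (Z i w - Z j w) 0 + Z k w
  else if m == j then Num.max (Z j w - Z i w) 0 + Z k w else Z m w.

Lemma measurable_burke1 (R : realType) :
  measurable_fun setT (fun z : R * R * R => Num.max (z.1.1 - z.1.2) 0 + z.2).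
Proof.
apply: measurable_funD; last exact: measurable_snd.
apply: measurable_maxr => //.
exact: (measurableT_comp (@measurable_diff R) measurable_fst).
Qed.

Lemma measurable_burke2 (R : realType) :
  measurable_fun setT (fun z : R * R * R => Num.max (z.1.2 - z.1.1) 0 + z.2).
Proof.
apply: measurable_funD; last exact: measurable_snd.
apply: measurable_maxr => //; apply: measurable_funB.
  exact: (measurableT_comp measurable_snd measurable_fst).
exact: (measurableT_comp measurable_fst measurable_fst).
Qed.

(** On any event of the remaining indices the triple [(Z i, Z j, Z k)] keeps its product law, so
    [burke_law] applies to it. The index [k] leaves the domain because its weight is absorbed into
    the two new values. *)
Lemma family_flip d (T : measurableType d) (R : realType) (P : probability T R)
    (I : eqType) (D : set I) (r : I -> R) (Z : I -> T -> R) (i j k : I) :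
  elaw_family P D r Z -> D i -> D j -> D k -> i != j -> i != k -> j != k ->
  r k = r i + r j -> elaw_family P [set m | D m /\ m != k] r (flip Z i j k).
Proof.
move=> [rpos mZ ZP] Di Dj Dk ij ik jk rk.
have mpair : measurable_fun setT (fun w => ((Z i w, Z j w), Z k w)).
  by apply: measurable_fun_pair; [apply: measurable_fun_pair|]; exact: mZ.
split=> [m [/rpos//]|m [Dm _]|s A us sD mA].
  rewrite /flip; case: eqP => _.
    exact: (measurableT_comp (@measurable_burke1 R) mpair).
  case: eqP => _; last exact: mZ.
  exact: (measurableT_comp (@measurable_burke2 R) mpair).
have := family_pad r A us ij; cbv zeta.
pose A' m := if m \in s then A m else setT.
pose s0 := [seq m <- s | (m != i) && (m != j)].
rewrite -/A' -/s0 => ->.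
have mA' m : measurable (A' m) by rewrite /A'; case: ifP.
have s0P m : m \in s0 -> [/\ D m, m != i, m != j & m != k].
  by rewrite mem_filter => /andP[/andP[? ?] /sD[]].
pose E : set T := [set w | forall m, m \in s0 -> A' m (Z m w)].
have mE : measurable E.
  by apply: measurable_family_event => // m /s0P[Dm _ _ _]; exact: mZ.
pose c := (\prod_(m <- s0) elaw (r m) (A' m))%E.
have fc : c \is a fin_num by exact: prod_elaw_fin_num.
have c0 : (0 <= c)%E by exact: prod_elaw_ge0.
(* The law of the triple is reached in two rounds of [pair_law]: here [Z k] is part of the
   conditioning event; in [law2] it is paired with [(Z i, Z j)]. *)
have law1 C : measurable C -> forall D2, measurable D2 ->
    P ((E `&` (Z k @^-1` C)) `&` [set w | D2 (Z i w, Z j w)]) =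
    (c * elaw (r k) C * (elaw (r i) \x elaw (r j))%E D2)%E.
  move=> mC D2 mD2.
  have fC : (c * elaw (r k) C)%E \is a fin_num by rewrite fin_numM// fin_num_measure.
  rewrite -(fineK fC); apply: pair_law => //; try exact: mZ.
  - by apply: measurableI => //; apply: measurable_preimageT => //; exact: mZ.
  - by apply: fine_ge0; rewrite mule_ge0.
  move=> A1 B1 mA1 mB1; rewrite fineK//.
  pose A'' m := if m == i then A1 else if m == j then B1 else if m == k then C else A' m.
  have mA'' m : measurable (A'' m) by rewrite /A''; do 3 case: ifP => // _.
  have us' : uniq [:: i, j, k & s0].
    rewrite /= !inE !negb_or ij ik jk /= filter_uniq// andbT.
    by apply/and3P; split; apply/negP => /s0P[_]; rewrite ?eqxx.
  have sD' m : m \in [:: i, j, k & s0] -> D m.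
    by rewrite !inE => /or4P[/eqP->|/eqP->|/eqP->|/s0P[]].
  have := ZP _ _ us' sD' mA''; rewrite !big_cons.
  have Ai : A'' i = A1 by rewrite /A'' eqxx.
  have Aj : A'' j = B1 by rewrite /A'' eqxx eq_sym (negbTE ij).
  have Ak : A'' k = C by rewrite /A'' eqxx eq_sym (negbTE ik) eq_sym (negbTE jk).
  have As m : m \in s0 -> A'' m = A' m.
    by move=> /s0P[_ mi mj mk]; rewrite /A'' (negbTE mi) (negbTE mj) (negbTE mk).
  have -> : (\prod_(m <- s0) elaw (r m) (A'' m) = c)%E.
    by apply: eq_big_seq => m /As ->.
  rewrite Ai Aj Ak.
  move=> PE; rewrite [RHS]muleC -!muleA [(c * _)%E]muleC -PE; congr (P _).
  apply/seteqP; split=> w /=; rewrite !forall_in_cons Ai Aj Ak.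
    by move=> [[Ew Cw] [Aw Bw]]; do ![split=> //] => m ms; rewrite As//; exact: Ew.
  by move=> [Aw [Bw [Cw Ew]]]; do ![split=> //] => m ms; rewrite -As//; exact: Ew.
pose B3 := [set z : R * R * R | A' i (Num.max (z.1.1 - z.1.2) 0 + z.2) /\
   A' j (Num.max (z.1.2 - z.1.1) 0 + z.2)].
have mB3 : measurable B3.
  apply: measurableI.
    exact: (measurable_preimageT (@measurable_burke1 R)).
  exact: (measurable_preimageT (@measurable_burke2 R)).
have law2 : P (E `&` [set w | B3 ((Z i w, Z j w), Z k w)]) =
    (c * (elaw (r i) \x elaw (r j) \x elaw (r k))%E B3)%E.
  rewrite -(fineK fc).
  apply: (@pair_law _ _ _ T (R * R)%type R R P (fun w => (Z i w, Z j w)) (Z k) E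
    [the probability _ R of (elaw (r i) \x elaw (r j))%E] (elaw (r k))) => //.
  - by apply: measurable_fun_pair; exact: mZ.
  - exact: mZ.
  - exact: fine_ge0.
  move=> D2 C mD2 mC; rewrite fineK//= [X in (_ * X)%E]muleC muleA -law1//.
  congr (P _); apply/seteqP; split=> w /=; tauto.
move: law2; rewrite rk burke_law ?rpos//.
rewrite muleC -muleA => <-; congr (P _).
apply/seteqP; split=> w /=.
  move=> h; split=> [m ms|].
    have [_ mi mj mk] := s0P m ms; move: ms; rewrite mem_filter => /andP[_ ms].
    by have := h m ms; rewrite /flip (negbTE mi) (negbTE mj) /A' ms.
  rewrite /B3 /A' /=; split; case: ifP => // ms; have := h _ ms; rewrite /flip eqxx//.
  by rewrite eq_sym (negbTE ij).
move=> [Ew []] /=; rewrite /A' => Aw Bw m ms; rewrite /flip.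
case: eqP => [mi|/eqP mi]; first by move: Aw; rewrite -mi ms.
case: eqP => [mj|/eqP mj]; first by move: Bw; rewrite -mj ms.
by have := Ew m; rewrite mem_filter mi mj ms /A' ms; apply.
Qed.

(** * Chernoff bounds for sums of independent exponentials *)

Lemma integral_mul_indep d (T : measurableType d) (R : realType) (P : probability T R)
    (X Y : T -> R) (f g : R -> \bar R) :
  measurable_fun setT X -> measurable_fun setT Y ->
  (forall A B, measurable A -> measurable B ->
     P (X @^-1` A `&` Y @^-1` B) = P (X @^-1` A) * P (Y @^-1` B))%E ->
  measurable_fun setT f -> (forall x, 0 <= f x)%E ->
  measurable_fun setT g -> (forall x, 0 <= g x)%E ->
  (\int[P]_w (f (X w) * g (Y w)) = \int[P]_w f (X w) * \int[P]_w g (Y w))%E.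
Proof.
move=> mX mY XY mf f0 mg g0.
pose X' : {mfun T >-> R} := mfun_Sub (mem_set mX).
pose Y' : {mfun T >-> R} := mfun_Sub (mem_set mY).
pose m1 : probability R R := [the probability R R of distribution P X'].
pose m2 : probability R R := [the probability R R of distribution P Y'].
have mXY : measurable_fun setT (fun w => (X w, Y w)) by exact: measurable_fun_pair.
pose XY' : {mfun T >-> (R * R)%type} := mfun_Sub (mem_set mXY).
pose F (z : R * R) := (f z.1 * g z.2)%E.
have F0 z : (0 <= F z)%E by rewrite mule_ge0.
have mF : measurable_fun setT F.
  apply: emeasurable_funM.
    exact: (measurableT_comp mf measurable_fst).
  exact: (measurableT_comp mg measurable_snd).
transitivity (\int[m1 \x m2]_z F z)%E.
  transitivity (\int[distribution P XY']_z F z)%E.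
    by rewrite ge0_integral_distribution.
  apply: eq_measure_integral => D mD _.
  have := @pair_law _ _ _ T R R R P X Y setT m1 m2 1 mX mY measurableT ler01 _ D mD.
  rewrite setTI mul1e; apply=> A B mA mB.
  by rewrite setTI mul1e XY.
rewrite fubini_tonelli1// /fubini_F /F /=.
under eq_integral do rewrite ge0_integralZl//.
rewrite ge0_integralZr//; last exact: integral_ge0.
by rewrite /m1 /m2 /= !ge0_integral_distribution.
Qed.

Lemma measurable_fun_sumR d (T : measurableType d) (R : realType) (I : eqType)
    (Z : I -> T -> R) (s : seq I) :
  (forall i, i \in s -> measurable_fun setT (Z i)) ->
  measurable_fun setT (fun w => \sum_(i <- s) Z i w).
Proof.
elim: s => [|i s ih] mZ; first by under eq_fun do rewrite big_nil; exact: measurable_cst.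
under eq_fun do rewrite big_cons.
apply: measurable_funD; first by apply: mZ; rewrite mem_head.
by apply: ih => j js; apply: mZ; rewrite in_cons js orbT.
Qed.

(** The list [s2] belongs to the statement because the induction moves the head of [s1] into it: the
    sum over the tail is then independent of [Z j] jointly with the other coordinates. *)
Lemma family_sum_indep d (T : measurableType d) (R : realType) (P : probability T R)
    (I : eqType) (D : set I) (r : I -> R) (Z : I -> T -> R) (s1 s2 : seq I)
    (A : I -> set R) (B : set R) :
  elaw_family P D r Z -> uniq (s1 ++ s2) -> (forall i, i \in s1 ++ s2 -> D i) ->
  (forall i, measurable (A i)) -> measurable B ->
  P ([set w | forall i, i \in s2 -> A i (Z i w)] `&` [set w | B (\sum_(i <- s1) Z i w)]) =
  ((\prod_(i <- s2) elaw (r i) (A i)) * P [set w | B (\sum_(i <- s1) Z i w)%R])%E.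
Proof.
move=> fam; have [_ mZ ZP] := fam.
elim: s1 s2 A B => [|j s1 ih] s2 A B us sD mA mB.
  rewrite -ZP//; have [B0|B0] := pselect (B 0).
    rewrite (_ : [set w | B _] = setT) ?setIT ?probability_setT ?mule1//.
    by apply/seteqP; split=> w //= _; rewrite big_nil.
  rewrite (_ : [set w | B _] = set0) ?setI0 ?measure0 ?mule0//.
  by apply/seteqP; split=> w //=; rewrite big_nil.
have mS : measurable_fun setT (fun w => \sum_(i <- s1) Z i w).
  by apply: measurable_fun_sumR => i si; apply/mZ/sD; rewrite /= in_cons mem_cat si orbT.
pose S : {mfun T >-> R} := mfun_Sub (mem_set mS).
have Dj : D j by apply: sD; rewrite mem_head.
pose D2 := [set z : R * R | B (z.1 + z.2)].
have mD2 : measurable D2.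
  apply: (@measurable_preimageT _ _ _ _ (fun z : R * R => z.1 + z.2)) mB.
  by apply: measurable_funD; [exact: measurable_fst|exact: measurable_snd].
have key (s : seq I) : uniq ((j :: s1) ++ s) -> (forall i, i \in (j :: s1) ++ s -> D i) ->
    P ([set w | forall i, i \in s -> A i (Z i w)] `&` [set w | D2 (Z j w, S w)]) =
    ((\prod_(i <- s) elaw (r i) (A i)) * (elaw (r j) \x distribution P S)%E D2)%E.
  move=> us' sD'.
  have fc : (\prod_(i <- s) elaw (r i) (A i))%E \is a fin_num by exact: prod_elaw_fin_num.
  rewrite -(fineK fc); apply: pair_law => //.
  - exact: mZ.
  - apply: measurable_family_event => // i si.
    by apply/mZ/sD'; rewrite mem_cat si orbT.
  - by apply: fine_ge0; exact: prod_elaw_ge0.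
  move=> C E mC mE; rewrite fineK//.
  pose A' i := if i == j then C else A i.
  have mA' i : measurable (A' i) by rewrite /A'; case: ifP.
  have js : j \notin s.
    by move: us'; rewrite /= mem_cat negb_or => /andP[/andP[]].
  have As i : i \in s -> A' i = A i.
    by move=> si; rewrite /A'; case: eqP => // ij; move: js; rewrite -ij si.
  have A'j : A' j = C by rewrite /A' eqxx.
  have us1 : uniq (s1 ++ j :: s).
    by rewrite uniq_catC cat_cons cons_uniq mem_cat orbC -mem_cat uniq_catC -cons_uniq.
  have sD1 i : i \in s1 ++ j :: s -> D i.
    by move=> si; apply: sD'; move: si; rewrite /= !(in_cons, mem_cat) orbCA.
  have := ih (j :: s) A' E us1 sD1 mA' mE.
  rewrite big_cons (eq_big_seq (fun i => elaw (r i) (A i))); last first.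
    by move=> i /As ->.
  rewrite A'j [(elaw _ _ * _)%E]muleC -muleA => <-; congr (P _).
  apply/seteqP; split=> w /=; rewrite forall_in_cons A'j.
    by move=> [h [Cw Ew]]; do ![split=> //] => i si; rewrite As//; exact: h.
  by move=> [[Cw h] Ew]; do ![split=> //] => i si; rewrite -As//; exact: h.
have DE w : B (\sum_(i <- j :: s1) Z i w) = D2 (Z j w, S w) by rewrite big_cons.
have key0 : P [set w | D2 (Z j w, S w)] = (elaw (r j) \x distribution P S)%E D2.
  have := key [::]; rewrite cats0 big_nil mul1e => <-.
  - by congr (P _); apply/seteqP; split=> w //= [].
  - by move: us; rewrite cat_uniq => /andP[].
  - by move=> i si; apply: sD; rewrite mem_cat si.
have -> : [set w | B (\sum_(i <- j :: s1) Z i w)] = [set w | D2 (Z j w, S w)].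
  by apply/funext => w /=; rewrite DE.
by rewrite key// key0.
Qed.

Lemma family_sum_mgf d (T : measurableType d) (R : realType) (P : probability T R)
    (I : eqType) (D : set I) (r : I -> R) (Z : I -> T -> R) (s : seq I) (rho t : R) :
  elaw_family P D r Z -> uniq s -> (forall i, i \in s -> D i) ->
  (forall i, i \in s -> r i = rho) -> 0 < rho -> t < rho ->
  (\int[P]_w (expR (t * \sum_(i <- s) Z i w))%:E = ((rho / (rho - t)) ^+ size s)%:E)%E.
Proof.
move=> fam us sD sr rho0 trho; have [_ mZ ZP] := fam.
elim: s us sD sr => [|j s ih] /= us sD sr.
  under eq_integral do rewrite big_nil mulr0 expR0.
  rewrite integral_cst// expr0 mul1e; exact: probability_setT.
have Dj : D j by apply: sD; rewrite mem_head.
have sD' i : i \in s -> D i by move=> si; apply: sD; rewrite in_cons si orbT.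
under eq_integral do rewrite big_cons mulrDr expRD EFinM.
have mexp : measurable_fun setT (fun x : R => (expR (t * x))%:E).
  apply/measurable_EFinP; apply: measurableT_comp => //; exact: measurable_funM.
rewrite (@integral_mul_indep _ T R P (Z j) (fun w => \sum_(i <- s) Z i w)
  (fun x => (expR (t * x))%:E) (fun x => (expR (t * x))%:E))//; first last.
- move=> A B mA mB.
  have us1 : uniq (s ++ [:: j]) by rewrite uniq_catC.
  have sD1 i : i \in s ++ [:: j] -> D i.
    by rewrite mem_cat inE orbC => h; apply: sD; rewrite inE.
  have := family_sum_indep fam us1 sD1 (fun=> mA) mB.
  rewrite big_seq1 (elaw_family_law fam)// => <-; congr (P _).
  by apply/seteqP; split=> w /= [h Bw]; split=> //; [move=> i; rewrite inE => /eqP->|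
    apply: h; rewrite inE].
- by apply: measurable_fun_sumR => i /sD' ?; exact: mZ.
- exact: mZ.
rewrite ih ?exprS ?EFinM//; last first.
- by move=> i si; apply: sr; rewrite in_cons si orbT.
- by case/andP: us.
congr (_ * _)%E; rewrite (@exp_mgf _ _ _ P (Z j) rho)//; first exact: mZ.
by move=> A mA; rewrite -(sr j (mem_head _ _)); exact: elaw_family_law fam Dj mA.
Qed.

(** With u = t/rho this is -ln(1 - u) <= u + 2u^2 for u <= 1/2. Negative [t] is included, for the
    lower tail. *)
Lemma mgf_ratio_le (R : realType) (rho t : R) : 0 < rho -> t <= rho / 2 ->
  rho / (rho - t) <= expR (t / rho + 2 * t ^+ 2 / rho ^+ 2).
Proof.
move=> rho0 trho; have rt0 : 0 < rho - t by lra.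
have -> : rho / (rho - t) = 1 + t / (rho - t) by field; lra.
apply: (le_trans (expR_ge1Dx _)); rewrite ler_expR.
have -> : t / rho + 2 * t ^+ 2 / rho ^+ 2 =
    t / (rho - t) + t ^+ 2 * (rho - 2 * t) / (rho ^+ 2 * (rho - t)).
  by field; rewrite !gt_eqF.
rewrite lerDl; apply: divr_ge0; apply: mulr_ge0; rewrite ?sqr_ge0 ?(ltW rt0)//; lra.
Qed.

Lemma family_sum_tail d (T : measurableType d) (R : realType) (P : probability T R)
    (I : eqType) (D : set I) (r : I -> R) (Z : I -> T -> R) (s : seq I) (rho t x : R) :
  elaw_family P D r Z -> uniq s -> (forall i, i \in s -> D i) ->
  (forall i, i \in s -> r i = rho) -> 0 < rho -> 0 < t -> t <= rho / 2 ->
  (P [set w | x <= `|\sum_(i <- s) Z i w - (size s)%:R / rho|]%R <=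
   (2 * expR (2 * t ^+ 2 * (size s)%:R / rho ^+ 2 - t * x))%:E)%E.
Proof.
move=> fam us sD sr rho0 t0 trho; have [_ mZ ZP] := fam.
set k := size s.
have mS : measurable_fun setT (fun w => \sum_(i <- s) Z i w).
  by apply: measurable_fun_sumR => i /sD ?; exact: mZ.
have mN : measurable_fun setT (fun w => - \sum_(i <- s) Z i w) by exact: measurable_funN.
pose S : {RV P >-> R} := mfun_Sub (mem_set mS).
pose N : {RV P >-> R} := mfun_Sub (mem_set mN).
have bnd (u : R) : u <= rho / 2 ->
    (\int[P]_w (expR (u * \sum_(i <- s) Z i w))%:E <=
     (expR (k%:R * (u / rho + 2 * u ^+ 2 / rho ^+ 2)))%:E)%E.
  move=> urho; have ur : u < rho by lra.
  rewrite (family_sum_mgf fam us sD sr)// lee_fin expRM_natl.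
  apply: lerXn2r; rewrite ?nnegrE ?expR_ge0//.
    by rewrite divr_ge0 ?subr_ge0 ?ltW.
  exact: mgf_ratio_le.
set bd := expR _.
have up : (P [set w | S w >= k%:R / rho + x]%R <= bd%:E)%E.
  apply: (le_trans (chernoff S _ t0)).
  rewrite /mmt_gen_fun unlock.
  under eq_integral do rewrite /= mulrC.
  apply: (le_trans (lee_wpmul2r _ (bnd t trho))); first by rewrite lee_fin expR_ge0.
  rewrite -EFinM -expRD lee_fin ler_expR le_eqVlt; apply/orP; left; apply/eqP.
  by field; rewrite gt_eqF.
have lo : (P [set w | N w >= - (k%:R / rho) + x]%R <= bd%:E)%E.
  apply: (le_trans (chernoff N _ t0)).
  rewrite /mmt_gen_fun unlock.
  under eq_integral do rewrite /= mulrC mulrN -mulNr.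
  have Nt : - t <= rho / 2 by lra.
  apply: (le_trans (lee_wpmul2r _ (bnd _ Nt))); first by rewrite lee_fin expR_ge0.
  rewrite -EFinM -expRD lee_fin ler_expR le_eqVlt; apply/orP; left; apply/eqP.
  by field; rewrite gt_eqF.
have mup : measurable [set w | S w >= k%:R / rho + x].
  have := measurable_preimageT mS (measurable_itv `[k%:R / rho + x, +oo[).
  by congr measurable; apply/seteqP; split=> w /=; rewrite in_itv /= andbT.
have mlo : measurable [set w | N w >= - (k%:R / rho) + x].
  have := measurable_preimageT mN (measurable_itv `[- (k%:R / rho) + x, +oo[).
  by congr measurable; apply/seteqP; split=> w /=; rewrite in_itv /= andbT.
apply: (@le_trans _ _ (P ([set w | S w >= k%:R / rho + x] `|`
    [set w | N w >= - (k%:R / rho) + x]))).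
  apply: le_measure; rewrite ?inE.
  - have mA : measurable_fun setT (fun w => `|\sum_(i <- s) Z i w - k%:R / rho|).
      by apply: measurableT_comp => //; exact: measurable_funB.
    have := measurable_preimageT mA (measurable_itv `[x, +oo[).
    by congr measurable; apply/seteqP; split=> w /=; rewrite in_itv /= andbT.
  - exact: measurableU.
  - move=> w /=; rewrite ler_normr => /orP[?|?]; [left|right]; lra.
apply: (le_trans (measureU2 _ mup mlo)).
rewrite (_ : 2 * bd = bd + bd); last by ring.
by rewrite EFinD; exact: leeD.
Qed.

(** * Deterministic last-passage recursion *)

(** One column of the recursion: [f] gives the passage times of the previous column and [g] the
    weights of the present one. Separating it makes both recursions structural. *)
Fixpoint colstep (R : realType) (f g : nat -> R) (b : nat) : R :=
  if b is b'.+1 then Num.max (f b) (colstep f g b') + g b' else 0.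

(* The last-passage time over the cells [i < a], [j < b]; it is 0 when
   [a = 0] or [b = 0], which is harmless for nonnegative weights. *)
Fixpoint lp (R : realType) (w : nat -> nat -> R) (a : nat) : nat -> R :=
  if a is a'.+1 then colstep (lp w a') (w a') else fun=> 0.

Definition sh (R : realType) (p q : nat) (w : nat -> nat -> R) i j := w (p + i)%N (q + j)%N.

(** The corner counts as part of the row: a path that leaves it upwards still collects
    [s * w 0 0]. *)
Definition bw (R : realType) (s t : R) (w : nat -> nat -> R) i j :=
  if j == 0%N then s * w i j else if i == 0%N then t * w i j else w i j.

Lemma lp0n (R : realType) (w : nat -> nat -> R) b : lp w 0 b = 0.
Proof. by []. Qed.

Lemma lpn0 (R : realType) (w : nat -> nat -> R) a : lp w a 0 = 0.
Proof. by case: a. Qed.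

Lemma lpSS (R : realType) (w : nat -> nat -> R) a b :
  lp w a.+1 b.+1 = Num.max (lp w a b.+1) (lp w a.+1 b) + w a b.
Proof. by []. Qed.

Lemma lp_ind (P : nat -> nat -> Prop) :
  (forall b, P 0 b) -> (forall a, P a 0) ->
  (forall a b, P a b.+1 -> P a.+1 b -> P a.+1 b.+1) -> forall a b, P a b.
Proof. by move=> P0 Pn PS; elim=> [|a iha]; elim=> [|b ihb]//; apply: PS. Qed.

Lemma le_lpw (R : realType) (w w' : nat -> nat -> R) (a b : nat) :
  (forall i j, (i < a)%N -> (j < b)%N -> w i j <= w' i j) -> lp w a b <= lp w' a b.
Proof.
pattern a, b; apply: lp_ind => {a b} [b _|a _|a b iha ihb ww']; rewrite ?lp0n ?lpn0//.
rewrite !lpSS lerD ?ww'// ge_max !le_max; apply/andP; split.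
  by rewrite iha// => i j ia jb; apply: ww' => //; rewrite ltnS ltnW.
by rewrite ihb ?orbT// => i j ia jb; apply: ww' => //; rewrite ltnS ltnW.
Qed.

Lemma lp_ge0 (R : realType) (w : nat -> nat -> R) (a b : nat) :
  (forall i j, 0 <= w i j) -> 0 <= lp w a b.
Proof.
move=> w0; pattern a, b; apply: lp_ind => {a b} [b|a|a b iha ihb]; rewrite ?lp0n ?lpn0//.
by rewrite lpSS addr_ge0// le_max iha.
Qed.

Lemma lpZ (R : realType) (c : R) (w : nat -> nat -> R) (a b : nat) : 0 <= c ->
  lp (fun i j => c * w i j) a b = c * lp w a b.
Proof.
move=> c0; pattern a, b; apply: lp_ind => {a b} [b|a|a b iha ihb]; rewrite ?lp0n ?lpn0 ?mulr0//.
by rewrite !lpSS iha ihb mulrDr maxr_pMr.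
Qed.

Lemma le_lp (R : realType) (w : nat -> nat -> R) (a b a' b' : nat) :
  (forall i j, 0 <= w i j) -> (a <= a')%N -> (b <= b')%N -> lp w a b <= lp w a' b'.
Proof.
move=> w0 aa' bb'.
have rS m n : lp w m n <= lp w m.+1 n.
  by case: n => [|n]; rewrite ?lpn0// lpSS ler_wpDr// le_max lexx.
have uS m n : lp w m n <= lp w m n.+1.
  by case: m => [|m]; rewrite ?lp0n// lpSS ler_wpDr// le_max lexx orbT.
apply: (@le_trans _ _ (lp w a' b)).
  apply: (@homo_leq _ (fun m => lp w m b) <=%O) aa' => //; exact: le_trans.
apply: (@homo_leq _ (lp w a') <=%O) bb' => //; exact: le_trans.
Qed.

Lemma lp_cat (R : realType) (w : nat -> nat -> R) (p q a b : nat) :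
  (forall i j, 0 <= w i j) ->
  lp w p q + lp (sh p q w) a b <= lp w (p + a) (q + b).
Proof.
move=> w0; pattern a, b; apply: lp_ind => {a b} [b|a|a b iha ihb].
- by rewrite lp0n addr0 le_lp// ?addn0// leq_addr.
- by rewrite lpn0 addr0 le_lp// ?addn0// leq_addr.
rewrite !addnS !lpSS addrA lerD// -lerBrDl ge_max !lerBrDl !le_max.
by rewrite -!addnS iha ihb orbT.
Qed.

(* [k] is given by the last diagonal point of an optimal path; the block on the right
   starts one column early because the path may leave this point upwards. *)
Lemma lp_last_diagonal (R : realType) (w u : nat -> nat -> R) (m n : nat) :
  (forall i j, 0 <= w i j) -> (forall i j, 0 <= u i j) ->
  (forall i j, (i < j)%N -> w i j = u i j) -> (m <= n)%N ->
  exists2 k, (k <= m)%N &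
    lp w m n <= lp w k k + lp (sh k.-1 k u) (m - k.-1) (n - k).
Proof.
move=> w0 u0 wu; have su0 p q i j : 0 <= sh p q u i j by exact: u0.
pattern m, n; apply: lp_ind => {m n} [n _|m|m n ihm ihn mn].
- by exists 0%N => //; rewrite lp0n add0r lp_ge0.
- by rewrite leqn0 => /eqP->; exists 0%N => //; rewrite lp0n add0r lp_ge0.
have [mn1|nm] := ltnP m n; last first.
  have -> : n = m by apply/eqP; rewrite eqn_leq nm.
  by exists m.+1 => //; rewrite lerDl lp_ge0.
rewrite lpSS wu//; have [h|h] := leP (lp w m.+1 n) (lp w m n.+1).
  have [k km le] := ihm (ltnW mn); exists k; first exact: leqW.
  apply: (le_trans (lerD le (lexx _))); rewrite -addrA lerD2l.
  have km' : (k.-1 <= m)%N := leq_trans (leq_pred k) km.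
  have kn : (k <= n)%N by rewrite (leq_trans km)// ltnW.
  rewrite [(m.+1 - _)%N]subSn// [(n.+1 - k)%N]subSn//.
  by rewrite lpSS /sh !subnKC// lerD2r le_max lexx.
have [k km le] := ihn mn1; exists k => //.
apply: (le_trans (lerD le (lexx _))); rewrite -addrA lerD2l.
have km' : (k.-1 <= m)%N by rewrite -ltnS; case: (k) km.
have kn : (k <= n)%N := leq_trans km mn1.
by rewrite [(n.+1 - k)%N]subSn// [(m.+1 - _)%N]subSn// lpSS /sh !subnKC// lerD2r le_max lexx orbT.
Qed.

(* [S1] and [S2] are the unscaled boundary weights collected by an optimal path
   on the row and on the column. *)
Lemma lp_exit (R : realType) (w : nat -> nat -> R) (s t : R) (a b : nat) :
  (forall i j, 0 <= w i j) -> 0 <= s -> 0 <= t -> (0 < a)%N -> (0 < b)%N ->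
  exists S1 S2 Q : R,
    [/\ [/\ 0 <= S1, 0 <= S2 & 0 <= Q], lp (bw s t w) a b = s * S1 + t * S2 + Q,
        forall s' t', 0 <= s' -> 0 <= t' -> s' * S1 + t' * S2 + Q <= lp (bw s' t' w) a b,
        Q <= lp w a b & S2 = 0 \/ S1 = w 0%N 0%N].
Proof.
move=> w0 s0 t0 a0 b0.
have bw0 s' t' i j : 0 <= s' -> 0 <= t' -> 0 <= bw s' t' w i j.
  by move=> ? ?; rewrite /bw; case: ifP => _; [|case: ifP => _]; rewrite ?mulr_ge0.
(* Strengthened for the induction: adding a cell to a single row must find [S2 = 0], and adding one
   to a single column must find [S1] equal to the corner weight. *)
suff : exists S1 S2 Q : R,
    [/\ [/\ 0 <= S1, 0 <= S2 & 0 <= Q], lp (bw s t w) a b = s * S1 + t * S2 + Q,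
        forall s' t', 0 <= s' -> 0 <= t' -> s' * S1 + t' * S2 + Q <= lp (bw s' t' w) a b,
        Q <= lp w a b &
        [/\ S2 = 0 \/ S1 = w 0%N 0%N, b = 1%N -> S2 = 0 & a = 1%N -> S1 = w 0%N 0%N]].
  by move=> [S1 [S2 [Q [? ? ? ? []]]]]; exists S1, S2, Q; split.
move: a0 b0; pattern a, b; apply: lp_ind => {a b} // a b.
case: a => [_|a].
  case: b => [_ _ _|b /(_ isT isT)].
    exists (w 0%N 0%N), 0, 0; rewrite !lpSS /= !maxxx !add0r.
    split=> //.
    - by rewrite /bw /=; ring.
    - by move=> s' t' _ _; rewrite /bw /= mulr0 !addr0 ?maxxx ?add0r.
    - by split; [left| |].
  move=> [S1 [S2 [Q [[S10 S20 Q0] E le Qle [S12 b1 a1]]]]] _ _.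
  exists S1, (S2 + w 0%N b.+1), Q; split.
  - by split=> //; rewrite addr_ge0.
  - rewrite lpSS lp0n max_r; last by apply: lp_ge0 => ? ?; exact: bw0.
    by rewrite E /bw /=; ring.
  - move=> s' t' s'0 t'0; rewrite lpSS lp0n max_r; last by apply: lp_ge0 => ? ?; exact: bw0.
    have := le _ _ s'0 t'0; have -> : bw s' t' w 0 b.+1 = t' * w 0%N b.+1 by [].
    lra.
  - by rewrite lpSS lp0n max_r ?lp_ge0//; apply: ler_wpDr.
  - by split=> //; right; exact: a1.
case: b => [/(_ isT isT) + _ _ _|b iha ihb _ _].
  move=> [S1 [S2 [Q [[S10 S20 Q0] E le Qle [S12 b1 a1]]]]].
  have S2E : S2 = 0 by exact: b1.
  exists (S1 + w a.+1 0%N), S2, Q; split.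
  - by split=> //; rewrite addr_ge0.
  - rewrite lpSS lpn0 max_l; last by apply: lp_ge0 => ? ?; exact: bw0.
    by rewrite E /bw /=; ring.
  - move=> s' t' s'0 t'0; rewrite lpSS lpn0 max_l; last by apply: lp_ge0 => ? ?; exact: bw0.
    have := le _ _ s'0 t'0; have -> : bw s' t' w a.+1 0 = s' * w a.+1 0%N by [].
    lra.
  - by rewrite lpSS lpn0 max_l ?lp_ge0//; apply: ler_wpDr.
  - by split=> //; left.
have bwE s' t' : bw s' t' w a.+1 b.+1 = w a.+1 b.+1 by [].
have [h|h] := leP (lp (bw s t w) a.+2 b.+1) (lp (bw s t w) a.+1 b.+2).
  have [S1 [S2 [Q [[S10 S20 Q0] E le Qle [S12 b1 a1]]]]] := iha isT isT.
  exists S1, S2, (Q + w a.+1 b.+1); split.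
  - by split=> //; rewrite addr_ge0.
  - by rewrite lpSS max_l// bwE E addrA.
  - move=> s' t' s'0 t'0; rewrite lpSS bwE addrA lerD2r le_max.
    by rewrite le.
  - by rewrite lpSS lerD2r le_max Qle.
  - by split.
have [S1 [S2 [Q [[S10 S20 Q0] E le Qle [S12 b1 a1]]]]] := ihb isT isT.
exists S1, S2, (Q + w a.+1 b.+1); split.
- by split=> //; rewrite addr_ge0.
- by rewrite lpSS max_r ?ltW// bwE E addrA.
- move=> s' t' s'0 t'0; rewrite lpSS bwE addrA lerD2r le_max.
  by rewrite le ?orbT.
- by rewrite lpSS lerD2r le_max Qle orbT.
- by split.
Qed.

(** * Operations on families and the law of the boundary weights *)

Lemma elaw_family_sub d (T : measurableType d) (R : realType) (P : probability T R)
    (I : eqType) (D D' : set I) (r : I -> R) (Z Z' : I -> T -> R) :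
  elaw_family P D r Z -> D' `<=` D -> (forall i, D' i -> Z' i =1 Z i) ->
  elaw_family P D' r Z'.
Proof.
move=> [r0 mZ ZP] DD ZZ; split=> [i /DD/r0//|i Di|s A us sD mA].
  by rewrite (funext (ZZ i Di)); exact/mZ/DD.
rewrite -ZP//; last by move=> i /sD/DD.
congr (P _); apply/seteqP; split=> w h i si; have := h i si; rewrite ZZ//; exact: sD.
Qed.

Lemma elaw_family_comp d (T : measurableType d) (R : realType) (P : probability T R)
    (I J : eqType) (D : set I) (D' : set J) (r : I -> R) (Z : I -> T -> R) (h : J -> I) :
  elaw_family P D r Z -> injective h -> (forall j, D' j -> D (h j)) ->
  elaw_family P D' (r \o h) (fun j => Z (h j)).
Proof.
move=> [r0 mZ ZP] hI DD; split=> [j /DD/r0//|j /DD/mZ//|s A us sD mA].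
(* The sets are transported along the injection [h]; indices outside its range receive the full
   set. *)
pose A' i := if pselect (exists j, h j = i) is left e then A (projT1 (cid e)) else setT.
have A'h j : A' (h j) = A j.
  rewrite /A'; case: pselect => [e|[]]; last by exists j.
  by congr A; apply: hI; case: (cid e).
have := ZP (map h s) A'; rewrite big_map; under eq_bigr do rewrite A'h.
move=> <-.
- congr (P _); apply/seteqP; split=> w H.
    by move=> _ /mapP[j js ->]; rewrite A'h; exact: H.
  by move=> j js; rewrite -A'h; apply: H; apply: map_f.
- by rewrite map_inj_uniq.
- by move=> _ /mapP[j /sD/DD Dj ->].
- by move=> i; rewrite /A'; case: pselect.
Qed.

Lemma elaw_family_scale d (T : measurableType d) (R : realType) (P : probability T R)
    (I : eqType) (D : set I) (r k : I -> R) (Z : I -> T -> R) :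
  elaw_family P D r Z -> (forall i, D i -> 0 < k i) ->
  elaw_family P D (fun i => r i / k i) (fun i w => k i * Num.max (Z i w) 0).
Proof.
move=> [r0 mZ ZP] k0.
have mk i : measurable_fun setT (fun x : R => k i * Num.max x 0).
  by apply: measurable_funM => //; exact: measurable_maxr.
split=> [i Di|i Di|s A us sD mA]; first by rewrite divr_gt0 ?r0 ?k0.
  exact: (measurableT_comp (mk i) (mZ i Di)).
rewrite (ZP s (fun i => [set x | A i (k i * Num.max x 0)]))//; last first.
  by move=> i; exact: (measurable_preimageT (mk i) (mA i)).
by apply: eq_big_seq => i /sD Di; rewrite elaw_posscale ?r0 ?k0.
Qed.

(** Row and column rates add up to the rate 1 of the interior, which is the rate condition of
    [family_flip] at every interior cell. *)
Definition bwrate (R : realType) (al : R) (v : nat * nat) : R :=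
  if v.2 == 0%N then al else if v.1 == 0%N then 1 - al else 1.

Lemma bw_family d (T : measurableType d) (R : realType) (P : probability T R)
    (X : nat * nat -> T -> R) (al : R) (p q : nat) : 0 < al -> al < 1 ->
  (forall v w, 0 <= X v w) -> elaw_family P setT (fun=> 1) X ->
  elaw_family P setT (bwrate al)
    (fun v w => bw al^-1 (1 - al)^-1 (sh p q (fun i j => X (i, j) w)) v.1 v.2).
Proof.
move=> al0 al1 X0 fam.
pose h (v : nat * nat) := (p + v.1, q + v.2)%N.
have hI : injective h.
  by move=> [i j] [i' j'] [/eqP + /eqP]; rewrite !eqn_add2l => /eqP-> /eqP->.
have fam1 := @elaw_family_comp _ _ _ _ _ _ _ setT _ _ _ fam hI (fun _ _ => I).
have k0 v : setT v -> 0 < (bwrate al v)^-1.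
  by move=> _; rewrite invr_gt0 /bwrate; case: ifP => // _; case: ifP => // _; lra.
have := elaw_family_scale fam1 k0.
congr elaw_family.
  by apply/funext => v /=; rewrite div1r invrK.
apply/funext => -[i j]; apply/funext => w /=; rewrite max_l// /bw /sh /bwrate /=.
by case: ifP => // _; case: ifP => // _; rewrite invr1 mul1r.
Qed.

(** * Increments of the stationary passage time *)

Definition hinc (R : realType) (w : nat -> nat -> R) (a l : nat) := lp w a.+1 l - lp w a l.
Definition vinc (R : realType) (w : nat -> nat -> R) (a l : nat) := lp w a l.+1 - lp w a l.

(** With [vinc_rec]: the increments on the lower and left sides of a cell and its weight determine
    those on the upper and right sides, exactly by the map of [burke_law]. *)
Lemma hinc_rec (R : realType) (w : nat -> nat -> R) (a l : nat) :
  Num.max (hinc w a l - vinc w a l) 0 + w a l = hinc w a l.+1.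
Proof.
rewrite /hinc /vinc lpSS.
by case: (leP (lp w a l.+1) (lp w a.+1 l)) => h; [rewrite max_l|rewrite max_r]; lra.
Qed.

Lemma vinc_rec (R : realType) (w : nat -> nat -> R) (a l : nat) :
  Num.max (vinc w a l - hinc w a l) 0 + w a l = vinc w a.+1 l.
Proof.
rewrite /hinc /vinc lpSS.
by case: (leP (lp w a l.+1) (lp w a.+1 l)) => h; [rewrite max_r|rewrite max_l]; lra.
Qed.

Lemma hinc_row0 (R : realType) (w : nat -> nat -> R) (a : nat) :
  (forall i j, 0 <= w i j) -> hinc w a 1 = w a 0%N.
Proof. by move=> w0; rewrite /hinc lpSS lpn0 max_l ?lp_ge0// addrAC subrr add0r. Qed.

Lemma vinc_col0 (R : realType) (w : nat -> nat -> R) (b : nat) :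
  (forall i j, 0 <= w i j) -> vinc w 1 b = w 0%N b.
Proof. by move=> w0; rewrite /vinc lpSS lp0n max_r ?lp_ge0// addrAC subrr add0r. Qed.

(* A single index set serves for increments and weights: once the cells [(a, j)],
   [1 <= j < l], have been processed, [(0, j)] holds the vertical increment of the
   passage time across row [j] on the current column, and [(a, 0)] the horizontal
   increment at height [l]. *)
Definition front (R : realType) (w : nat -> nat -> R) (a l : nat) (v : nat * nat) : R :=
  if v.1 == 0%N then (if (v.2 < l)%N then vinc w a.+1 v.2 else vinc w a v.2)
  else if v == (a, 0%N) then hinc w a l else w v.1 v.2.

(** The interior cells already swept are absent, since Burke moves have absorbed their weights. The
    height [b] keeps the sweep of each column finite. *)
Definition front_dom (b a l : nat) : set (nat * nat) :=
  [set v | [\/ v.1 = 0%N /\ (0 < v.2 < b)%N, v = (a, 0%N), v.1 = a /\ (l <= v.2)%N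
             | (a < v.1)%N]].

(** Each Burke move at [(a, l)] raises the height by one; a column swept up to [b] serves as the
    left boundary of the next. *)
Lemma front_family d (T : measurableType d) (R : realType) (P : probability T R)
    (w : nat * nat -> T -> R) (al : R) (b : nat) :
  0 < al -> al < 1 -> (forall v x, 0 <= w v x) -> elaw_family P setT (bwrate al) w ->
  forall a, (0 < a)%N -> forall l, (0 < l)%N -> (l <= b)%N ->
  elaw_family P (front_dom b a l) (bwrate al)
    (fun v x => front (fun i j => w (i, j) x) a l v).
Proof.
move=> al0 al1 w0 fam.
have step a l : (0 < a)%N -> (0 < l)%N -> (l < b)%N ->
    elaw_family P (front_dom b a l) (bwrate al)
      (fun v x => front (fun i j => w (i, j) x) a l v) ->
    elaw_family P (front_dom b a l.+1) (bwrate al)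
      (fun v x => front (fun i j => w (i, j) x) a l.+1 v).
  move=> a0 l0 lb faml.
  have aN0 : (a == 0%N) = false by rewrite gtn_eqF.
  have lN0 : (l == 0%N) = false by rewrite gtn_eqF.
  have H1 : front_dom b a l (a, 0%N) by apply: Or42.
  have H2 : front_dom b a l (0%N, l) by apply: Or41; rewrite /= l0 lb.
  have H3 : front_dom b a l (a, l) by apply: Or43; split.
  have H := @family_flip _ _ _ _ _ _ _ _ (a, 0%N) (0%N, l) (a, l) faml H1 H2 H3.
  apply: elaw_family_sub (H _ _ _ _) _ _.
  - by rewrite xpair_eqE aN0.
  - by rewrite xpair_eqE eqxx eq_sym lN0.
  - by rewrite xpair_eqE eq_sym aN0.
  - by rewrite /bwrate /= aN0 lN0 /=; ring.
  - move=> [i j] /= [[/= ? /= ?]|[-> ->]|[/= -> /= lj]|/= ai].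
    + split; first by apply: Or41.
      by apply/eqP => -[ia _]; lia.
    + split; first by apply: Or42.
      by apply/eqP => -[]; lia.
    + split; first by apply: Or43; split => //=; lia.
      by apply/eqP => -[]; lia.
    + split; first by apply: Or44.
      by apply/eqP => -[]; lia.
  - move=> [i j] Dij x; rewrite /flip.
    case: (eqVneq (i, j) (a, 0%N)) => [[-> ->]|ne1].
      by rewrite /front /= aN0 eqxx ltnn -hinc_rec xpair_eqE eqxx lN0.
    case: (eqVneq (i, j) (0%N, l)) => [[-> ->]|ne2].
      by rewrite /front /= aN0 eqxx ltnn ltnSn -vinc_rec xpair_eqE eqxx lN0.
    rewrite /front /= (negbTE ne1); case: eqP => // i0.
    have jl : (j != l) by move: ne2; rewrite i0 xpair_eqE eqxx.
    by rewrite ltnS leq_eqVlt (negbTE jl).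
case=> // a _; elim: a => [|a iha] l l0 lb.
  elim: l l0 lb => // l ihl _ lb.
  case: l ihl lb => [_ b0|l ihl lb]; last by apply: step => //; apply: ihl => //; exact: ltnW.
  apply: elaw_family_sub fam _ _ => //.
  move=> [i j] Dij x; rewrite /front /=.
  case: Dij => [[/= -> /= /andP[j0 jb]]|[-> ->]|[/= -> /= j1]|/= i1].
  - by rewrite ltnNge j0 /= vinc_col0.
  - by rewrite /= hinc_row0.
  - by rewrite xpair_eqE [j == _]gtn_eqF ?andbF.
  - by rewrite xpair_eqE [i == 0%N]gtn_eqF ?(ltnW i1)// [i == 1%N]gtn_eqF.
elim: l l0 lb => // l ihl _ lb.
case: l ihl lb => [_ b0|l ihl lb]; last by apply: step => //; apply: ihl => //; exact: ltnW.
(* A new column starts: the vertical increments are those of the finished column, and at height 1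
   the horizontal increment is a fresh row weight. *)
apply: elaw_family_sub (iha b b0 (leqnn b)) _ _.
  move=> [i j] [[/= ? /= ?]|[-> ->]|[/= -> /= j1]|/= i1].
  - exact: Or41.
  - by apply: Or44 => /=.
  - by apply: Or44 => /=.
  - by apply: Or44 => /=; exact: ltnW.
move=> [i j] Dij x; rewrite /front /=.
case: Dij => [[/= -> /= /andP[j0 jb]]|[-> ->]|[/= -> /= j1]|/= i1].
- by rewrite ltnNge j0 jb.
- by rewrite eqxx /= xpair_eqE eqn_leq ltnn /= hinc_row0.
- by rewrite !xpair_eqE [j == _]gtn_eqF ?andbF.
- rewrite !xpair_eqE [i == 0%N]gtn_eqF ?(leq_ltn_trans _ i1)//.
  by rewrite [i == a.+2]gtn_eqF// [i == a.+1]gtn_eqF// ltnW.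
Qed.

(** * Concentration of the stationary passage time in one box *)

Lemma lp_row (R : realType) (w : nat -> nat -> R) (a : nat) :
  (forall i j, 0 <= w i j) -> lp w a 1 = \sum_(0 <= i < a) w i 0%N.
Proof.
move=> w0; elim: a => [|a ih]; first by rewrite big_geq.
by rewrite lpSS lpn0 max_l ?lp_ge0// big_nat_recr//= -ih.
Qed.

Lemma lp_col_telescope (R : realType) (w : nat -> nat -> R) (a b : nat) :
  lp w a b.+1 = lp w a 1 + \sum_(1 <= j < b.+1) vinc w a j.
Proof.
elim: b => [|b ih]; first by rewrite big_geq// addr0.
by rewrite big_nat_recr//= addrA -ih /vinc; ring.
Qed.

Lemma measurable_lp d (T : measurableType d) (R : realType)
    (w : nat -> nat -> T -> R) (a b : nat) :
  (forall i j, measurable_fun setT (w i j)) ->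
  measurable_fun setT (fun x => lp (fun i j => w i j x) a b).
Proof.
move=> mw; pattern a, b; apply: lp_ind => {a b} [b|a|a b iha ihb].
- exact: measurable_cst.
- by under eq_fun do rewrite lpn0; exact: measurable_cst.
- by apply: measurable_funD => //; exact: measurable_maxr.
Qed.

Lemma measurable_dist_ge d (T : measurableType d) (R : realType) (f : T -> R) (m x : R) :
  measurable_fun setT f -> measurable [set w | x <= `|f w - m|].
Proof.
move=> mf; have mA : measurable_fun setT (fun w => `|f w - m|).
  by apply: measurableT_comp => //; exact: measurable_funB.
have := measurable_preimageT mA (measurable_itv `[x, +oo[).
by congr measurable; apply/seteqP; split=> w /=; rewrite in_itv /= andbT.
Qed.

(** Following the bottom row and then the last column writes the passage time as two sums of
    independent exponentials, whose tails are added by a union bound. Height [b.+1] leaves [b]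
    vertical increments because the row occupies height 1. The bounds [m] and [K] make the estimate
    uniform in the box. *)
Lemma lp_bw_tail d (T : measurableType d) (R : realType) (P : probability T R)
    (w : nat * nat -> T -> R) (al m t K x : R) (a b : nat) :
  0 < al -> al < 1 -> (forall v x, 0 <= w v x) -> elaw_family P setT (bwrate al) w ->
  0 < m -> m <= al -> m <= 1 - al -> 0 < t -> t <= m / 2 ->
  (0 < a)%N -> a%:R <= K -> b%:R <= K ->
  (P [set z | 2 * x <= `|lp (fun i j => w (i, j) z) a b.+1 - (a%:R / al + b%:R / (1 - al))|]%R
   <= (4 * expR (2 * t ^+ 2 * K / m ^+ 2 - t * x))%:E)%E.
Proof.
move=> al0 al1 w0 fam m0 mal mal1 t0 tm a0 aK bK.
have al10 : 0 < 1 - al by lra.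
pose s1 := [seq (i, 0%N) | i <- iota 0 a].
pose s2 := [seq (0%N, j) | j <- iota 1 b].
pose V v z := front (fun i j => w (i, j) z) a 1 v.
have famV : elaw_family P (front_dom b.+1 a 1) (bwrate al) V by exact: front_family.
have bnd (rho : R) k : m <= rho -> k%:R <= K ->
    2 * expR (2 * t ^+ 2 * k%:R / rho ^+ 2 - t * x) <=
    2 * expR (2 * t ^+ 2 * K / m ^+ 2 - t * x).
  move=> mrho kK; rewrite ler_pM2l// ler_expR lerD2r.
  have k0 : 0 <= k%:R :> R by [].
  have t20 : 0 <= 2 * t ^+ 2 by rewrite mulr_ge0// sqr_ge0.
  apply: ler_pM; [exact: mulr_ge0|by rewrite invr_ge0 sqr_ge0|exact: ler_wpM2l|].
  rewrite lef_pV2 ?posrE ?exprn_gt0//; last exact: lt_le_trans mrho.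
  by rewrite lerXn2r// nnegrE ltW//; exact: lt_le_trans mrho.
have i1 : injective (fun i : nat => (i, 0%N)) by move=> ? ? [].
have i2 : injective (fun j : nat => (0%N, j)) by move=> ? ? [].
have t1 := @family_sum_tail _ _ _ P _ _ _ _ s1 al t x fam.
have t2 := @family_sum_tail _ _ _ P _ _ _ _ s2 (1 - al) t x famV.
rewrite !size_map !size_iota in t1 t2.
have {}t1 : (P [set z | x <= `|\sum_(v <- s1) w v z - a%:R / al|]%R <=
    (2 * expR (2 * t ^+ 2 * K / m ^+ 2 - t * x))%:E)%E.
  apply: (le_trans (t1 _ _ _ _ _ _)) => //; last by rewrite lee_fin bnd.
  - by rewrite map_inj_uniq// iota_uniq.
  - by move=> _ /mapP[i _ ->].
  - by lra.
have {}t2 : (P [set z | x <= `|\sum_(v <- s2) V v z - b%:R / (1 - al)|]%R <=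
    (2 * expR (2 * t ^+ 2 * K / m ^+ 2 - t * x))%:E)%E.
  apply: (le_trans (t2 _ _ _ _ _ _)) => //; last by rewrite lee_fin bnd.
  - by rewrite map_inj_uniq// iota_uniq.
  - by move=> _ /mapP[j + ->]; rewrite mem_iota => jb; apply: Or41; split.
  - by move=> _ /mapP[j + ->]; rewrite mem_iota /bwrate /= => /andP[j0 _]; rewrite gtn_eqF.
  - by lra.
have [_ mw _] := fam; have [_ mV _] := famV.
have mS1 : measurable_fun setT (fun z => \sum_(v <- s1) w v z).
  by apply: measurable_fun_sumR => v _; exact: mw.
have mS2 : measurable_fun setT (fun z => \sum_(v <- s2) V v z).
  apply: measurable_fun_sumR => _ /mapP[j + ->].
  by rewrite mem_iota => jb; apply: mV; apply: Or41; split.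
have lpE z : lp (fun i j => w (i, j) z) a b.+1 =
    \sum_(v <- s1) w v z + \sum_(v <- s2) V v z.
  rewrite lp_col_telescope lp_row// !big_map; congr (_ + _).
  - by rewrite /index_iota subn0.
  - rewrite /index_iota subSS subn0; apply: eq_big_seq => j.
    by rewrite mem_iota => /andP[j0 _]; rewrite /V /front /= ltnNge j0.
apply: (@le_trans _ _ (P ([set z | x <= `|\sum_(v <- s1) w v z - a%:R / al|] `|`
    [set z | x <= `|\sum_(v <- s2) V v z - b%:R / (1 - al)|]))).
  apply: le_measure; rewrite ?inE.
  - by apply: measurable_dist_ge; apply: measurable_lp => i j; exact: mw.
  - by apply: measurableU; exact: measurable_dist_ge.
  - move=> z /=; rewrite lpE => h.
    have [?|h1] := leP x `|\sum_(v <- s1) w v z - a%:R / al|; first by left.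
    right; rewrite leNgt; apply/negP => h2.
    have := ler_normD (\sum_(v <- s1) w v z - a%:R / al) (\sum_(v <- s2) V v z - b%:R / (1 - al)).
    rewrite addrACA -opprD; lra.
apply: (le_trans (measureU2 _ (measurable_dist_ge _ _ mS1) (measurable_dist_ge _ _ mS2))).
rewrite (_ : 4 * expR _ = 2 * expR (2 * t ^+ 2 * K / m ^+ 2 - t * x) +
  2 * expR (2 * t ^+ 2 * K / m ^+ 2 - t * x)); last by ring.
by rewrite EFinD; exact: leeD.
Qed.

(** * Almost sure concentration, uniformly over boxes *)

Lemma finite_union_bound d (T : measurableType d) (R : realType) (P : probability T R)
    (I : eqType) (s : seq I) (B : I -> set T) (c : R) :
  (forall i, i \in s -> measurable (B i)) -> (forall i, i \in s -> P (B i) <= c%:E)%E ->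
  measurable [set w | exists2 i, i \in s & B i w] /\
  (P [set w | exists2 i, i \in s & B i w] <= ((size s)%:R * c)%:E)%E.
Proof.
elim: s => [|i s ih] mB Bc.
  rewrite (_ : mkset _ = set0); last by apply/seteqP; split=> w // [].
  by split=> //; rewrite measure0 mul0r.
have [mU PU] := ih (fun j js => mB j (@mem_behead _ (i :: s) j js))
  (fun j js => Bc j (@mem_behead _ (i :: s) j js)).
rewrite (_ : mkset _ = B i `|` [set w | exists2 i, i \in s & B i w]); last first.
  apply/seteqP; split=> w /=.
    by move=> [j]; rewrite inE => /orP[/eqP->|js Bj]; [left|right; exists j].
  by move=> [Bi|[j js Bj]]; [exists i; rewrite ?mem_head|exists j => //; rewrite inE js orbT].
split; first by apply: measurableU => //; apply: mB; rewrite mem_head.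
apply: (le_trans (measureU2 _ (mB i (mem_head _ _)) mU)).
rewrite /= -natr1 mulrDl mul1r addrC EFinD; apply: leeD => //.
by apply: Bc; rewrite mem_head.
Qed.

Lemma sum_geometric_le (R : realType) (c q : R) (n : nat) : 0 <= c -> 0 <= q -> q < 1 ->
  \sum_(0 <= i < n) c * q ^+ i <= c / (1 - q).
Proof.
move=> c0 q0 q1; have q10 : 0 < 1 - q by lra.
have -> : \sum_(0 <= i < n) c * q ^+ i = c / (1 - q) - c * q ^+ n / (1 - q).
  elim: n => [|n ih]; first by rewrite big_geq// expr0 mulr1 subrr.
  by rewrite big_nat_recr//= ih exprS; field; lra.
by rewrite gerBl; apply: divr_ge0; [apply: mulr_ge0 => //; exact: exprn_ge0|exact: ltW].
Qed.

Lemma borel_cantelli_geometric d (T : measurableType d) (R : realType)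
    (P : probability T R) (F : nat -> set T) (c q : R) (n0 : nat) :
  0 <= c -> 0 <= q -> q < 1 -> (forall n, (n0 <= n)%N -> measurable (F n)) ->
  (forall n, (n0 <= n)%N -> P (F n) <= (c * q ^+ n)%:E)%E ->
  {ae P, forall w, exists N, forall n, (N <= n)%N -> ~ F n w}.
Proof.
move=> c0 q0 q1 mF PF.
pose G n := F (n0 + n)%N.
have mG n : measurable (G n) by apply: mF; exact: leq_addr.
have PG n : (P (G n) <= (c * q ^+ n)%:E)%E.
  apply: (le_trans (PF _ (leq_addr _ _))).
  by rewrite lee_fin ler_wpM2l// ler_wiXn2l ?leq_addl// ltW.
have sumG : (\sum_(n <oo) P (G n) < +oo)%E.
  apply: (@le_lt_trans _ _ (c / (1 - q))%:E); last exact: ltry.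
  apply: lime_le; first by apply: is_cvg_nneseries.
  apply: nearW => n; apply: (le_trans (lee_sum _ (fun i _ => PG i))).
  by rewrite sumEFin lee_fin sum_geometric_le.
have G0 := lim_sup_set_cvg0 mG sumG.
exists (lim_sup_set G); split => //.
  by apply: bigcap_measurable => // k _; apply: bigcup_measurable => n _; exact: mG.
move=> w /= nw k _; apply: contrapT => h; apply: nw.
exists (n0 + k)%N => n kn Fn; apply: h; exists (n - n0)%N => /=; first lia.
by rewrite /G subnKC//; lia.
Qed.

(** Uniform in the shift [(p, q)] as well as in the sides, since the blocks used later sit at
    positions that move with [n]. *)
Definition bw_good (R : realType) (X : nat -> nat -> R) (al : R) : Prop :=
  forall (e : R) (M : nat), 0 < e -> exists N, forall n, (N <= n)%N ->
  forall p q a b, (p <= M * n)%N -> (q <= M * n)%N -> (a <= M * n)%N -> (b <= M * n)%N ->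
    (0 < a)%N -> (0 < b)%N ->
    `|lp (bw al^-1 (1 - al)^-1 (sh p q X)) a b - (a%:R / al + b%:R / (1 - al))| <= e * n%:R.

(** The fourth power counts the choices of [p], [q], [a], [b]. Each factor costs an eighth of the
    exponential rate, so half of it remains. *)
Lemma pow4_expR_le (R : realType) (M kap : R) (n : nat) : 0 <= M -> 0 < kap ->
  (M * n%:R + 1) ^+ 4 * (4 * expR (- kap * n%:R)) <=
  (4 * (1 + 8 * M / kap) ^+ 4) * expR (- kap / 2) ^+ n.
Proof.
move=> M0 kap0; have n0 : 0 <= n%:R :> R by [].
set K := 1 + 8 * M / kap.
have K1 : 1 <= K by rewrite lerDl divr_ge0 ?mulr_ge0// ltW.
have le1 : M * n%:R + 1 <= K * expR (kap * n%:R / 8).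
  apply: (@le_trans _ _ (K * (1 + kap * n%:R / 8))); last first.
    by rewrite ler_pM2l ?expR_ge1Dx//; lra.
  have -> : K * (1 + kap * n%:R / 8) = K + kap * n%:R / 8 + M * n%:R.
    by rewrite /K; field; rewrite gt_eqF.
  have : 0 <= kap * n%:R / 8 by rewrite divr_ge0// mulr_ge0// ltW.
  lra.
have le4 : (M * n%:R + 1) ^+ 4 <= K ^+ 4 * expR (kap * n%:R / 2).
  have -> : K ^+ 4 * expR (kap * n%:R / 2) = (K * expR (kap * n%:R / 8)) ^+ 4.
    by rewrite exprMn -expRM_natl; congr (_ * expR _); field.
  by apply: lerXn2r; rewrite ?nnegrE// ?addr_ge0 ?mulr_ge0 ?expR_ge0//; lra.
apply: (@le_trans _ _ (K ^+ 4 * expR (kap * n%:R / 2) * (4 * expR (- kap * n%:R)))).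
  by apply: ler_wpM2r le4; rewrite mulr_ge0 ?expR_ge0.
rewrite -expRM_natl mulrACA -expRD mulrC [X in _ <= X * _]mulrC mulrC.
by rewrite le_eqVlt; apply/orP; left; apply/eqP; congr (_ * expR _); field.
Qed.

Lemma bw_good_ae d (T : measurableType d) (R : realType) (P : probability T R)
    (X : nat * nat -> T -> R) (al : R) : 0 < al -> al < 1 ->
  (forall v w, 0 <= X v w) -> elaw_family P setT (fun=> 1) X ->
  {ae P, forall w, bw_good (fun i j => X (i, j) w) al}.
Proof.
move=> al0 al1 X0 fam.
pose dev w p q a b := `|lp (bw al^-1 (1 - al)^-1 (sh p q (fun i j => X (i, j) w))) a b -
  (a%:R / al + b%:R / (1 - al))|.
suff fixed (e : R) (M : nat) : 0 < e -> {ae P, forall w, exists N, forall n, (N <= n)%N ->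
    forall p q a b, (p <= M * n)%N -> (q <= M * n)%N -> (a <= M * n)%N -> (b <= M * n)%N ->
    (0 < a)%N -> (0 < b)%N -> dev w p q a b <= e * n%:R}.
  have h : {ae P, forall w, forall k M, exists N, forall n, (N <= n)%N ->
      forall p q a b, (p <= M * n)%N -> (q <= M * n)%N -> (a <= M * n)%N ->
      (b <= M * n)%N -> (0 < a)%N -> (0 < b)%N -> dev w p q a b <= k.+1%:R^-1 * n%:R}.
    by apply/ae_foralln => k; apply/ae_foralln => M; apply: fixed; rewrite invr_gt0.
  apply: filterS h => w h e M e0.
  have [N hN] := h (Num.truncn e^-1) M; exists N => n Nn p q a b pM qM aM bM a0 b0.
  apply: (le_trans (hN n Nn p q a b pM qM aM bM a0 b0)); rewrite ler_wpM2r//.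
  by rewrite invf_ple ?posrE// ltW// truncnS_gt.
move=> e0.
have al10 : 0 < 1 - al by lra.
pose m := Num.min al (1 - al).
have m0 : 0 < m by rewrite lt_min al0.
have mal : m <= al by rewrite ge_min lexx.
have mal1 : m <= 1 - al by rewrite ge_min lexx orbT.
pose M' : R := M%:R + 1.
have M'0 : 0 < M' by rewrite /M' ltr_wpDl.
(* With deviation [x = e * n / 4], this [t] makes the quadratic term of the Chernoff exponent at
   most half of the linear one, which leaves the rate [kap = t * e / 8]. *)
pose t := Num.min (m / 2) (e * m ^+ 2 / (16 * M')).
have t0 : 0 < t.
  rewrite lt_min divr_gt0//= divr_gt0// ?mulr_gt0// exprn_gt0//.
have tm : t <= m / 2 by rewrite ge_min lexx.
have te : t <= e * m ^+ 2 / (16 * M') by rewrite ge_min lexx orbT.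
pose kap := t * e / 8.
have kap0 : 0 < kap by rewrite divr_gt0// mulr_gt0.
(* From [n0] on, [(1 - al)^-1], the gap between the centrings for heights [b] and [b.-1], is at most
   [e * n / 2]. *)
pose n0 := (Num.truncn (2 / (e * (1 - al)))).+1.
pose I n := ('I_(M * n).+1 * 'I_(M * n).+1 * 'I_(M * n).+1 * 'I_(M * n).+1)%type.
pose B n (u : I n) : set T :=
  if (0 < u.1.2)%N && (0 < u.2)%N then
    [set w | e * n%:R <= dev w u.1.1.1 u.1.1.2 u.1.2 u.2] else set0.
pose F n := [set w | exists2 u, u \in enum {: I n} & B n u w].
have famw p q := bw_family p q al0 al1 X0 fam.
have w0 p q (v : nat * nat) w :
    0 <= bw al^-1 (1 - al)^-1 (sh p q (fun i j => X (i, j) w)) v.1 v.2.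
  rewrite /bw /sh; case: ifP => _; [|case: ifP => _];
    by rewrite ?mulr_ge0 ?invr_ge0 ?(ltW al0) ?(ltW al10).
have mlp p q a b : measurable_fun setT (fun w =>
    lp (bw al^-1 (1 - al)^-1 (sh p q (fun i j => X (i, j) w))) a b).
  apply: (@measurable_lp _ T R
    (fun i j w => bw al^-1 (1 - al)^-1 (sh p q (fun i j => X (i, j) w)) i j)) => i j.
  by have [_ h _] := famw p q; exact: (h (i, j)).
have FB n : (n0 <= n)%N -> measurable (F n) /\
    (P (F n) <= ((size (enum {: I n}))%:R * (4 * expR (- kap * n%:R)))%:E)%E.
  move=> n0n; apply: finite_union_bound => -[[[p q] a] b] _; rewrite /B /=.
    by case: ifP => // _; exact: measurable_dist_ge.
  case: ifP => [/andP[a0 b0]|_]; last by rewrite measure0 lee_fin mulr_ge0 ?expR_ge0.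
  have n0R : 0 <= n%:R :> R by [].
  have aM : (a%:R : R) <= M' * n%:R.
    have : ((a : nat)%:R : R) <= (M * n)%:R by rewrite ler_nat -ltnS.
    by rewrite natrM /M' mulrDl mul1r; lra.
  have bM : ((b.-1)%:R : R) <= M' * n%:R.
    have : (((b : nat).-1)%:R : R) <= (M * n)%:R.
      by rewrite ler_nat (leq_trans (leq_pred _))// -ltnS.
    by rewrite natrM /M' mulrDl mul1r; lra.
  have nbig : 2 / (1 - al) <= e * n%:R.
    have : 2 / (e * (1 - al)) <= n%:R.
      by apply: (le_trans (ltW (truncnS_gt _))); rewrite ler_nat.
    have -> : 2 / (1 - al) = e * (2 / (e * (1 - al))) by field; rewrite !gt_eqF.
    by rewrite ler_pM2l.
  have := lp_bw_tail (e * n%:R / 4) al0 al1 (w0 p q) (famw p q) m0 mal mal1 t0 tm a0 aM bM.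
  move=> tail; apply: le_trans (le_trans tail _); last first.
    rewrite lee_fin ler_pM2l// ler_expR.
    have : 2 * t ^+ 2 * (M' * n%:R) / m ^+ 2 <= t * e * n%:R / 8.
      have -> : t * e * n%:R / 8 = 2 * t * (e * m ^+ 2 / (16 * M')) * (M' * n%:R) / m ^+ 2.
        by field; rewrite !gt_eqF.
      rewrite ler_wpM2r ?invr_ge0 ?sqr_ge0// ler_wpM2r ?mulr_ge0 ?(ltW M'0)//.
      by rewrite expr2 mulrA ler_wpM2l// mulr_ge0// ltW.
    rewrite /kap; lra.
  apply: le_measure; rewrite ?inE; try exact: measurable_dist_ge.
  move=> w /=; rewrite /dev (_ : (b : nat) = b.-1.+1); last by rewrite prednK.
  set z := lp _ _ _; rewrite -pred_Sn -natr1 mulrDl mul1r => h.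
  have := ler_normD (z - (a%:R / al + b.-1%:R / (1 - al))) (- (1 - al)^-1).
  rewrite normrN (gtr0_norm (_ : 0 < (1 - al)^-1)) ?invr_gt0//.
  have -> : z - (a%:R / al + b.-1%:R / (1 - al)) - (1 - al)^-1 =
    z - (a%:R / al + (b.-1%:R / (1 - al) + (1 - al)^-1)) by ring.
  lra.
have bc : {ae P, forall w, exists N, forall n, (N <= n)%N -> ~ F n w}.
  apply: (@borel_cantelli_geometric _ _ _ P F (4 * (1 + 8 * M%:R / kap) ^+ 4)
    (expR (- kap / 2)) n0).
  - rewrite mulr_ge0// exprn_ge0// addr_ge0// divr_ge0 ?mulr_ge0// ltW//.
  - exact: expR_ge0.
  - by rewrite expR_lt1; lra.
  - by move=> n /FB[].
  - move=> n /FB[_ h]; apply: (le_trans h); rewrite lee_fin.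
    apply: le_trans (pow4_expR_le n (ler0n _ M) kap0).
    rewrite -cardE !card_prod !card_ord -natrM natr1 -natrX.
    by rewrite ler_wpM2r ?mulr_ge0 ?expR_ge0// ler_nat !expnS expn0 muln1 !mulnA.
apply: filterS bc => w [N hN]; exists N => n Nn p q a b pM qM aM bM a0 b0.
rewrite leNgt; apply/negP => h; apply: (hN n Nn).
exists (inord p, inord q, inord a, inord b); first by rewrite mem_enum inE.
by rewrite /B /= !inordK ?ltnS// a0 b0 /=; exact: ltW.
Qed.

(** * Upper and lower bounds for the model without boundary *)

Lemma lp_upper (R : realType) (X : nat -> nat -> R) (al e : R) (M : nat) :
  (forall i j, 0 <= X i j) -> 0 < al -> al < 1 -> bw_good X al -> 0 < e ->
  exists N, forall n, (N <= n)%N ->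
  forall p q a b, (p <= M * n)%N -> (q <= M * n)%N -> (a <= M * n)%N -> (b <= M * n)%N ->
  lp (sh p q X) a b <= a%:R / al + b%:R / (1 - al) + e * n%:R.
Proof.
move=> X0 al0 al1 good e0; have al10 : 0 < 1 - al by lra.
have [N hN] := good e M e0; exists N => n Nn p q a b pM qM aM bM.
have f0 : 0 <= a%:R / al + b%:R / (1 - al) + e * n%:R.
  by rewrite !addr_ge0 ?mulr_ge0 ?invr_ge0 ?(ltW al0) ?(ltW al10) ?(ltW e0).
have [a0|a0] := posnP a; first by rewrite {1}a0.
have [b0|b0] := posnP b; first by rewrite {1}b0 lpn0.
have := hN n Nn p q a b pM qM aM bM a0 b0; rewrite ler_norml => /andP[_ h].
apply: (@le_trans _ _ (lp (bw al^-1 (1 - al)^-1 (sh p q X)) a b)); last lra.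
apply: le_lpw => i j _ _; rewrite /bw.
have S0 : 0 <= sh p q X i j by exact: X0.
have h1 : 1 <= al^-1 by rewrite invf_ge1// ltW.
have h2 : 1 <= (1 - al)^-1 by rewrite invf_ge1//; lra.
by case: ifP => _; [|case: ifP => _//]; rewrite ler_peMl.
Qed.

(** Flatness at the minimizer is an exact identity: al^2/be + (1 - al)^2/(1 - be) = 1 + (al -
    be)^2/(be (1 - be)). *)
Lemma bw_value_le (R : realFieldType) (al be kap m eta d nu A B : R) :
  0 < m -> m / 2 <= be -> m / 2 <= 1 - be -> (al - be) ^+ 2 = eta ^+ 2 ->
  0 <= kap -> 0 <= nu -> 0 <= d ->
  `|A - kap * al ^+ 2 * nu| <= d * nu -> `|B - kap * (1 - al) ^+ 2 * nu| <= d * nu ->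
  A / be + B / (1 - be) <= nu * (kap + 4 * kap * eta ^+ 2 / m ^+ 2 + 4 * d / m).
Proof.
move=> m0 mb mb1 ab kap0 nu0 d0; rewrite !ler_norml => /andP[_ hA] /andP[_ hB].
have be0 : 0 < be by lra.
have be1 : 0 < 1 - be by lra.
have dn0 : 0 <= d * nu by exact: mulr_ge0.
have inv2 (z : R) : m / 2 <= z -> z^-1 <= 2 / m.
  move=> mz; have z0 : 0 < z by lra.
  by rewrite ler_pdivlMr// mulrC ler_pdivrMr//; lra.
have lA : A / be <= kap * al ^+ 2 * nu / be + d * nu * (2 / m).
  have : A / be <= (kap * al ^+ 2 * nu + d * nu) / be by rewrite ler_pM2r ?invr_gt0//; lra.
  have := ler_wpM2l dn0 (inv2 _ mb); rewrite mulrDl; lra.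
have lB : B / (1 - be) <= kap * (1 - al) ^+ 2 * nu / (1 - be) + d * nu * (2 / m).
  have : B / (1 - be) <= (kap * (1 - al) ^+ 2 * nu + d * nu) / (1 - be).
    by rewrite ler_pM2r ?invr_gt0//; lra.
  have := ler_wpM2l dn0 (inv2 _ mb1); rewrite mulrDl; lra.
have id : kap * al ^+ 2 * nu / be + kap * (1 - al) ^+ 2 * nu / (1 - be) =
    kap * nu + kap * nu * eta ^+ 2 * (be^-1 * (1 - be)^-1).
  by rewrite -ab; field; rewrite !gt_eqF.
have : kap * nu * eta ^+ 2 * (be^-1 * (1 - be)^-1) <= kap * nu * eta ^+ 2 * (2 / m * (2 / m)).
  apply: ler_wpM2l; first by rewrite mulr_ge0 ?sqr_ge0// mulr_ge0.
  by apply: ler_pM; rewrite ?invr_ge0 ?(ltW be0) ?(ltW be1)//; exact: inv2.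
have -> : nu * (kap + 4 * kap * eta ^+ 2 / m ^+ 2 + 4 * d / m) =
    kap * nu + kap * nu * eta ^+ 2 * (2 / m * (2 / m)) + d * nu * (2 / m) + d * nu * (2 / m).
  by field; rewrite gt_eqF.
lra.
Qed.

Lemma bw_value_ge (R : realFieldType) (al kap m d nu A B : R) :
  0 < m -> m <= al -> m <= 1 - al -> 0 <= nu -> 0 <= d ->
  `|A - kap * al ^+ 2 * nu| <= d * nu -> `|B - kap * (1 - al) ^+ 2 * nu| <= d * nu ->
  nu * (kap - 4 * d / m) <= A / al + B / (1 - al).
Proof.
move=> m0 mb mb1 nu0 d0; rewrite !ler_norml => /andP[hA _] /andP[hB _].
have al0 : 0 < al by lra.
have al1 : 0 < 1 - al by lra.
have dn0 : 0 <= d * nu by exact: mulr_ge0.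
have inv2 (z : R) : m <= z -> z^-1 <= 2 / m.
  move=> mz; have z0 : 0 < z by lra.
  by rewrite ler_pdivlMr// mulrC ler_pdivrMr//; lra.
have lA : kap * al ^+ 2 * nu / al - d * nu * (2 / m) <= A / al.
  have : (kap * al ^+ 2 * nu - d * nu) / al <= A / al by rewrite ler_pM2r ?invr_gt0//; lra.
  have := ler_wpM2l dn0 (inv2 _ mb); rewrite mulrBl; lra.
have lB : kap * (1 - al) ^+ 2 * nu / (1 - al) - d * nu * (2 / m) <= B / (1 - al).
  have : (kap * (1 - al) ^+ 2 * nu - d * nu) / (1 - al) <= B / (1 - al).
    by rewrite ler_pM2r ?invr_gt0//; lra.
  have := ler_wpM2l dn0 (inv2 _ mb1); rewrite mulrBl; lra.
have id : kap * al ^+ 2 * nu / al + kap * (1 - al) ^+ 2 * nu / (1 - al) = kap * nu.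
  by field; rewrite !gt_eqF.
have -> : nu * (kap - 4 * d / m) = kap * nu - d * nu * (2 / m) - d * nu * (2 / m).
  by field; rewrite gt_eqF.
lra.
Qed.

(** Here [F0] and [F1] are the centrings at [al] and at the perturbed parameter, and [u] is the
    boundary share. Taking [d] proportional to [eta] keeps the error small after division by [eta].
    With 38, the losses in units of e/38 are 19 + 12 from [u], 2 from [d / m] and 3 from [d]: 36 in
    all. *)
Lemma boundary_share_le (R : realFieldType) (kap m e eta nu F0 F1 u : R) :
  0 < m -> m <= 1 -> 0 < kap -> 0 < eta -> eta <= 1 / 2 ->
  eta <= e * m ^+ 2 / (8 * kap) -> 0 < e -> 0 <= nu ->
  let d := e * m * eta / 38 in
  nu * (kap - 4 * d / m) <= F0 ->
  F1 <= nu * (kap + 4 * kap * eta ^+ 2 / m ^+ 2 + 4 * d / m) ->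
  u * eta <= F1 - F0 + 4 * (d * nu) ->
  (kap - e) * nu <= F0 - 3 * (d * nu) - u.
Proof.
move=> m0 m1 kap0 eta0 eta1 etae e0 nu0 d lo up hu.
have dm : d / m <= e / 76.
  have -> : d / m = e / 38 * eta by rewrite /d; field; rewrite gt_eqF.
  have -> : e / 76 = e / 38 * (1 / 2) by field.
  by apply: ler_wpM2l => //; rewrite divr_ge0// ltW.
have de : d <= e / 38.
  have -> : d = e / 38 * (m * eta) by rewrite /d; field.
  rewrite -[leRHS]mulr1 ler_wpM2l ?divr_ge0 ?(ltW e0)//.
  by apply: mulr_ile1; rewrite ?(ltW m0) ?(ltW eta0)//; clear -eta1; lra.
pose D := 4 * kap * eta ^+ 2 / m ^+ 2 + 8 * d / m + 4 * d.
have Deta : D / eta <= e / 2 + 12 * e / 38.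
  have -> : D / eta = 4 * kap / m ^+ 2 * eta + 8 * e / 38 + 4 * m * e / 38.
    by rewrite /D /d; field; rewrite !gt_eqF.
  have : 4 * kap / m ^+ 2 * eta <= 4 * kap / m ^+ 2 * (e * m ^+ 2 / (8 * kap)).
    apply: ler_wpM2l; last exact: etae.
    by apply: divr_ge0; [apply: mulr_ge0 => //; exact: ltW|exact: sqr_ge0].
  have -> : 4 * kap / m ^+ 2 * (e * m ^+ 2 / (8 * kap)) = e / 2 by field; rewrite !gt_eqF.
  have : m * e <= 1 * e by rewrite ler_pM2r.
  by clear; lra.
have uD : u * eta <= nu * D.
  have -> : nu * D = nu * (kap + 4 * kap * eta ^+ 2 / m ^+ 2 + 4 * d / m) -
    nu * (kap - 4 * d / m) + 4 * (d * nu) by rewrite /D; ring.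
  by apply: (le_trans hu); clear -lo up; lra.
have ub : u <= nu * (e / 2 + 12 * e / 38).
  apply: (@le_trans _ _ (nu * (D / eta))); last exact: ler_wpM2l.
  by rewrite mulrA ler_pdivlMr.
have P1 := ler_wpM2l nu0 dm; have P2 := ler_wpM2l nu0 de.
have lo' : nu * kap - 4 * (nu * (d / m)) <= F0.
  by apply: le_trans lo; rewrite le_eqVlt; apply/orP; left; apply/eqP; ring.
have en : 0 <= nu * e by rewrite mulr_ge0// ltW.
clear -P1 P2 lo' ub en; lra.
Qed.

Lemma lp_lower (R : realType) (X : nat -> nat -> R) (al kap e : R) (M : nat) :
  (forall i j, 0 <= X i j) -> 0 < al -> al < 1 -> 0 < kap -> bw_good X al ->
  (forall k : nat, 0 < al - k.+1%:R^-1 -> bw_good X (al - k.+1%:R^-1)) ->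
  (forall k : nat, al + k.+1%:R^-1 < 1 -> bw_good X (al + k.+1%:R^-1)) -> 0 < e ->
  exists2 dl : R, 0 < dl & exists N, forall n, (N <= n)%N ->
  forall p q a b, (p <= M * n)%N -> (q <= M * n)%N -> (a <= M * n)%N -> (b <= M * n)%N ->
    (0 < a)%N -> (0 < b)%N ->
    `|a%:R - kap * al ^+ 2 * n%:R| <= dl * n%:R ->
    `|b%:R - kap * (1 - al) ^+ 2 * n%:R| <= dl * n%:R ->
  (kap - e) * n%:R <= lp (sh p q X) a b.
Proof.
move=> X0 al0 al1 kap0 good goodm goodp e0; have al10 : 0 < 1 - al by lra.
pose m := Num.min al (1 - al).
have m0 : 0 < m by rewrite lt_min al0.
have mal : m <= al by rewrite ge_min lexx.
have mal1 : m <= 1 - al by rewrite ge_min lexx orbT.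
have [k hk] : exists k : nat, k.+1%:R^-1 <= Num.min (m / 2) (e * m ^+ 2 / (8 * kap)).
  pose z := Num.min (m / 2) (e * m ^+ 2 / (8 * kap)).
  have z0 : 0 < z by rewrite lt_min !divr_gt0 ?mulr_gt0 ?exprn_gt0.
  exists (Num.truncn z^-1); rewrite invf_ple ?posrE//; exact/ltW/truncnS_gt.
pose eta : R := k.+1%:R^-1; rewrite -/eta le_min in hk; case/andP: hk => etam etae.
have eta0 : 0 < eta by rewrite invr_gt0.
have em : 0 < al - eta by lra.
have ep : al + eta < 1 by lra.
pose ep0 := e * m * eta / 38.
have ep00 : 0 < ep0 by rewrite divr_gt0// !mulr_gt0.
(* [M.+1] makes the 1 by 1 box admissible even when [M = 0]. *)
have [N1 h1] := good ep0 M.+1 ep00.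
have [N2 h2] := goodm k em ep0 M ep00.
have [N3 h3] := goodp k ep ep0 M ep00.
exists ep0 => //.
pose N4 := (Num.truncn ((al^-1 + (1 - al)^-1) / ep0)).+1.
exists (maxn (maxn N1 N2) (maxn N3 N4)) => n.
rewrite !geq_max => /andP[/andP[nN1 nN2] /andP[nN3 nN4]] p q a b pM qM aM bM a0 b0 ha hb.
have nu0 : 0 <= n%:R :> R by [].
set nu : R := n%:R in nu0 ha hb *.
have nbig : al^-1 + (1 - al)^-1 <= ep0 * nu.
  rewrite mulrC -ler_pdivrMr//; apply: (le_trans (ltW (truncnS_gt _))).
  by rewrite ler_nat.
have sub c : (c <= M * n)%N -> (c <= M.+1 * n)%N.
  by move=> h; apply: (leq_trans h); rewrite leq_mul2r leqnSn orbT.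
have n1 : (0 < n)%N by exact: leq_trans nN4.
have H1 := h1 n nN1 p q a b (sub _ pM) (sub _ qM) (sub _ aM) (sub _ bM) a0 b0.
have n1M : (1 <= M.+1 * n)%N by rewrite muln_gt0.
have H11 := h1 n nN1 p q 1%N 1%N (sub _ pM) (sub _ qM) n1M n1M isT isT.
have H2 := h2 n nN2 p q a b pM qM aM bM a0 b0.
have H3 := h3 n nN3 p q a b pM qM aM bM a0 b0.
rewrite -/nu -/eta in H1 H11 H2 H3.
have al0i : 0 <= al^-1 by rewrite invr_ge0 ltW.
have al1i : 0 <= (1 - al)^-1 by rewrite invr_ge0 ltW.
have em1 : 0 < 1 - (al - eta) by clear -al1 eta0; lra.
have ep1 : 0 < 1 - (al + eta) by rewrite subr_gt0.
have ep2 : 0 < al + eta by rewrite addr_gt0.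
have shX0 i j : 0 <= sh p q X i j by exact: X0.
have [S1 [S2 [Q [[S10 S20 Q0] Elp Hlp Qle S12]]]] :=
  @lp_exit _ (sh p q X) al^-1 (1 - al)^-1 a b shX0 al0i al1i a0 b0.
apply: le_trans Qle.
have ep0' := ltW ep00; have kap0' := ltW kap0.
have m1 : m <= 1 by clear -mal al1; lra.
have eta12 : eta <= 1 / 2 by clear -m1 etam; lra.
have V0 := bw_value_ge m0 mal mal1 nu0 ep0' ha hb.
have share F1 u := @boundary_share_le _ kap m e eta nu _ F1 u m0 m1 kap0 eta0 eta12
  etae e0 nu0 V0.
cbv zeta in share; rewrite -/ep0 in share.
have epnu : 0 <= ep0 * nu by exact: mulr_ge0.
rewrite Elp ler_norml in H1; case/andP: H1 => H1 _.
set F0 := a%:R / al + b%:R / (1 - al) in H1 share.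
(* A path that exits through the row is tested with [al - eta], which makes the row heavier: its
   share [al^-1 * S1] grows by the factor 1 + eta/(al - eta), which is at least 1 + eta. An exit
   through the column is tested with [al + eta]. *)
have [S2z|S1z] := S12.
  have V : a%:R / (al - eta) + b%:R / (1 - (al - eta)) <=
      nu * (kap + 4 * kap * eta ^+ 2 / m ^+ 2 + 4 * ep0 / m).
    apply: bw_value_le ha hb => //.
    - by clear -mal etam; lra.
    - by clear -mal1 m0 eta0; lra.
    - by congr (_ ^+ 2); ring.
  have := Hlp (al - eta)^-1 (1 - (al - eta))^-1.
  rewrite !invr_ge0 (ltW em) (ltW em1) S2z !mulr0 !addr0 => /(_ isT isT) Hm.
  rewrite S2z mulr0 addr0 in H1.
  rewrite ler_norml in H2; case/andP: H2 => _ H2.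
  have dS : al^-1 * S1 * eta <= (al - eta)^-1 * S1 - al^-1 * S1.
    have -> : (al - eta)^-1 * S1 - al^-1 * S1 = al^-1 * S1 * eta * (al - eta)^-1.
      by field; rewrite !gt_eqF.
    rewrite ler_peMr ?mulr_ge0 ?(ltW eta0)// invf_ge1//.
    by clear -al1 eta0; lra.
  apply: (le_trans (share _ (al^-1 * S1) V _)).
    by clear -dS H1 H2 Hm epnu; lra.
  by clear -H1 epnu; lra.
(* In the column case [S1] is the corner weight alone, which is the passage time of the 1 by 1 box
   and hence negligible. *)
have X00 : al^-1 * S1 <= 2 * (ep0 * nu).
  rewrite S1z; move: H11; rewrite ler_norml => /andP[_].
  by rewrite lpSS lp0n lpn0 maxxx add0r /bw /= !mul1r; clear -nbig; lra.
have V : a%:R / (al + eta) + b%:R / (1 - (al + eta)) <=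
    nu * (kap + 4 * kap * eta ^+ 2 / m ^+ 2 + 4 * ep0 / m).
  apply: bw_value_le ha hb => //.
  - by clear -mal m0 eta0; lra.
  - by clear -mal1 etam; lra.
  - by rewrite opprD addrA subrr sub0r sqrrN.
have := Hlp (al + eta)^-1 (1 - (al + eta))^-1.
rewrite !invr_ge0 (ltW ep2) (ltW ep1) => /(_ isT isT) Hp.
rewrite ler_norml in H3; case/andP: H3 => _ H3.
have dS : (1 - al)^-1 * S2 * eta <= (1 - (al + eta))^-1 * S2 - (1 - al)^-1 * S2.
  have -> : (1 - (al + eta))^-1 * S2 - (1 - al)^-1 * S2 =
      (1 - al)^-1 * S2 * eta * (1 - (al + eta))^-1.
    by field; rewrite !gt_eqF.
  rewrite ler_peMr ?mulr_ge0 ?(ltW eta0)// invf_ge1//.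
  by clear -al0 eta0; lra.
have S1p : 0 <= (al + eta)^-1 * S1 by rewrite mulr_ge0// invr_ge0 ltW.
apply: (le_trans (share _ ((1 - al)^-1 * S2) V _)).
  by clear -dS S1p X00 H1 H3 Hp; lra.
by clear -H1 X00; lra.
Qed.

(** Perturbations by [1/(k+1)] are fine enough, and being countable they share one almost sure
    event. *)
Definition nearby_good (R : realType) (X : nat -> nat -> R) (al : R) : Prop :=
  [/\ bw_good X al,
      forall k : nat, 0 < al - k.+1%:R^-1 -> bw_good X (al - k.+1%:R^-1) &
      forall k : nat, al + k.+1%:R^-1 < 1 -> bw_good X (al + k.+1%:R^-1)].

(** * Boxes growing linearly in a fixed direction *)

Definition box (R : realType) (w : nat -> nat -> R) (x y : R) (n : nat) : R :=
  lp w (Num.truncn (n%:R * x)) (Num.truncn (n%:R * y)).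

Definition ev_ge (R : realType) (u : nat -> R) (l : R) : Prop :=
  forall e, 0 < e -> exists N, forall n, (N <= n)%N -> (l - e) * n%:R <= u n.

Definition ev_le (R : realType) (u : nat -> R) (l : R) : Prop :=
  forall e, 0 < e -> exists N, forall n, (N <= n)%N -> u n <= (l + e) * n%:R.

Lemma ev_cvg (R : realType) (u : nat -> R) (l : R) : ev_ge u l -> ev_le u l ->
  (fun n : nat => n%:R^-1 * u n) @ \oo --> l.
Proof.
move=> lo up; apply/cvgrPdist_le => e e0.
have [N1 h1] := lo e e0; have [N2 h2] := up e e0.
exists (maxn 1 (maxn N1 N2)) => // n /=; rewrite !geq_max => /andP[n1 /andP[n2 n3]].
have n0 : 0 < n%:R :> R by rewrite ltr0n.
have := h1 n n2; have := h2 n n3 => hu hl.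
have u1 : n%:R^-1 * u n <= l + e by rewrite ler_pdivrMl// mulrC.
have u2 : l - e <= n%:R^-1 * u n by rewrite ler_pdivlMl// mulrC.
by rewrite ler_norml; apply/andP; split; lra.
Qed.

Lemma truncn_bounds (R : realType) (z : R) : 0 <= z ->
  (Num.truncn z)%:R <= z /\ z - 1 <= (Num.truncn z)%:R.
Proof.
move=> z0; split; first by rewrite truncn_le.
by have := ltW (truncnS_gt z); rewrite -natr1; lra.
Qed.

Lemma truncn_near (R : realType) (z d : R) : 0 <= z -> 0 < d ->
  exists N, forall n, (N <= n)%N ->
    `|(Num.truncn (n%:R * z))%:R - z * n%:R| <= d * n%:R.
Proof.
move=> z0 d0; exists (Num.truncn d^-1).+1 => n nN.
have [h1 h2] := @truncn_bounds _ (n%:R * z) (mulr_ge0 (ler0n _ _) z0).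
have : 1 <= d * n%:R.
  rewrite mulrC -ler_pdivrMr// mul1r; apply: (le_trans (ltW (truncnS_gt _))).
  by rewrite ler_nat.
by rewrite ler_norml [z * _]mulrC => ?; apply/andP; split; lra.
Qed.

Lemma truncn_bound_nat (R : realType) (z : R) : 0 <= z ->
  exists M, forall n, (Num.truncn (n%:R * z) <= M * n)%N.
Proof.
move=> z0; exists (Num.truncn z).+1 => n.
rewrite -(ler_nat R); apply: (@le_trans _ _ (n%:R * z)); first by rewrite truncn_le mulr_ge0.
by rewrite natrM mulrC ler_wpM2r// ltW// truncnS_gt.
Qed.

Lemma lp_lower_dir (R : realType) (X : nat -> nat -> R) (al kap e : R) (M : nat) :
  (forall i j, 0 <= X i j) -> 0 < al -> al < 1 -> 0 < kap -> nearby_good X al -> 0 < e ->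
  exists2 dl : R, 0 < dl & exists N, forall n, (N <= n)%N ->
  forall p q a b, (p <= M * n)%N -> (q <= M * n)%N -> (a <= M * n)%N -> (b <= M * n)%N ->
    `|a%:R - kap * al ^+ 2 * n%:R| <= dl * n%:R ->
    `|b%:R - kap * (1 - al) ^+ 2 * n%:R| <= dl * n%:R ->
  (kap - e) * n%:R <= lp (sh p q X) a b.
Proof.
move=> X0 al0 al1 kap0 [g0 gm gp] e0.
have [d d0 [N hN]] := lp_lower M X0 al0 al1 kap0 g0 gm gp e0.
have x0 : 0 < kap * al ^+ 2 by rewrite mulr_gt0// exprn_gt0.
have y0 : 0 < kap * (1 - al) ^+ 2 by rewrite mulr_gt0// exprn_gt0// subr_gt0.
pose dl := Num.min d (Num.min (kap * al ^+ 2 / 2) (kap * (1 - al) ^+ 2 / 2)).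
have dl0 : 0 < dl by rewrite !lt_min d0 !divr_gt0.
have dld : dl <= d by rewrite ge_min lexx.
have dlx : dl <= kap * al ^+ 2 / 2 by rewrite !ge_min lexx orbT.
have dly : dl <= kap * (1 - al) ^+ 2 / 2 by rewrite !ge_min lexx !orbT.
exists dl => //; exists N.+1 => n nN p q a b pM qM aM bM ha hb.
have n0 : 0 < n%:R :> R by rewrite ltr0n (leq_trans _ nN).
have pos (z : R) (c : nat) : 0 < z -> dl <= z / 2 -> `|c%:R - z * n%:R| <= dl * n%:R -> (0 < c)%N.
  move=> z0 dz; rewrite ler_norml => /andP[h _]; rewrite -(ltr0n R).
  have : dl * n%:R <= z / 2 * n%:R by rewrite ler_pM2r.
  have : 0 < z * n%:R by rewrite mulr_gt0.
  lra.
apply: hN => //; first exact: ltnW.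
- exact: pos ha.
- exact: pos hb.
- by apply: (le_trans ha); rewrite ler_pM2r.
- by apply: (le_trans hb); rewrite ler_pM2r.
Qed.

Lemma lp_chain (R : realType) (w : nat -> nat -> R) (v : R) (a b K : nat) :
  (forall i j, 0 <= w i j) ->
  (forall k, (k < K)%N -> v <= lp (sh (k.+1 * a) (k * b) w) a b) ->
  v * K%:R <= lp w (K.+1 * a) (K * b).
Proof.
move=> w0; elim: K => [|K ih] h; first by rewrite mulr0 lp_ge0.
rewrite -natr1 mulrDr mulr1 [(K.+2 * a)%N]mulSn addnC [(K.+1 * b)%N]mulSn [(b + _)%N]addnC.
apply: le_trans (lp_cat _ _ _ _ w0); apply: lerD; last exact: h.
by apply: ih => k kK; apply: h; exact: ltnW.
Qed.

(** * Asymptotic bounds for weights with two rates *)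

Lemma box_lower (R : realType) (X w : nat -> nat -> R) (al kap c : R) :
  (forall i j, 0 <= X i j) -> 0 < al -> al < 1 -> 0 < kap -> nearby_good X al ->
  0 < c -> (forall i j, c^-1 * X i j <= w i j) ->
  ev_ge (box w (kap * al ^+ 2) (kap * (1 - al) ^+ 2)) (c^-1 * kap).
Proof.
move=> X0 al0 al1 kap0 good c0 Xw e e0.
have x0 : 0 <= kap * al ^+ 2 by rewrite mulr_ge0 ?sqr_ge0// ltW.
have y0 : 0 <= kap * (1 - al) ^+ 2 by rewrite mulr_ge0 ?sqr_ge0// ltW.
have [M1 hM1] := truncn_bound_nat x0; have [M2 hM2] := truncn_bound_nat y0.
have ce0 : 0 < c * e by rewrite mulr_gt0.
have [d d0 [N hN]] := lp_lower_dir (maxn M1 M2) X0 al0 al1 kap0 good ce0.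
have [N1 hN1] := truncn_near x0 d0; have [N2 hN2] := truncn_near y0 d0.
exists (maxn N (maxn N1 N2)) => n; rewrite !geq_max => /andP[n1 /andP[n2 n3]].
have := hN n n1 0%N 0%N (Num.truncn (n%:R * (kap * al ^+ 2)))
  (Num.truncn (n%:R * (kap * (1 - al) ^+ 2))) isT isT.
move=> /(_ _ _ (hN1 n n2) (hN2 n n3)) H.
have {}H := H (leq_trans (hM1 n) _) (leq_trans (hM2 n) _).
apply: (@le_trans _ _ (c^-1 * lp X (Num.truncn (n%:R * (kap * al ^+ 2)))
  (Num.truncn (n%:R * (kap * (1 - al) ^+ 2))))).
  have -> : (c^-1 * kap - e) * n%:R = c^-1 * ((kap - c * e) * n%:R).
    by field; rewrite gt_eqF.
  rewrite ler_pM2l ?invr_gt0//; apply: H; rewrite leq_mul2r ?leq_maxl ?leq_maxr ?orbT//.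
rewrite -lpZ ?invr_ge0 ?(ltW c0)//; apply: le_lpw => i j _ _; exact: Xw.
Qed.

(* Blocks along the segment, each shifted by one block width so that all of them
   lie in the region [j <= i]. *)
Lemma box_lower_diag (R : realType) (X w : nat -> nat -> R) (al kap c : R) :
  (forall i j, 0 <= X i j) -> (forall i j, 0 <= w i j) ->
  0 < al -> al < 1 -> 0 < kap -> nearby_good X al ->
  0 < c -> (forall i j, (j <= i)%N -> c^-1 * X i j <= w i j) -> 1 - al <= al ->
  ev_ge (box w (kap * al ^+ 2) (kap * (1 - al) ^+ 2)) (c^-1 * kap).
Proof.
move=> X0 w0 al0 al1 kap0 good c0 Xw alh e e0.
(* The chain has [K] blocks, one fewer than the [K.+1] pieces of the segment. This [K] makes the
   missing piece [kap'] at most [c * e / 2]; the errors [e'] use the other half. *)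
pose K := Num.truncn (2 * kap / (c * e)).
have ce0 : 0 < c * e by rewrite mulr_gt0.
have K1 : 0 < K.+1%:R :> R by [].
have hK : 2 * kap / (c * e) <= K.+1%:R by exact/ltW/truncnS_gt.
pose kap' := kap / K.+1%:R; pose e' := c * e / (2 * K.+1%:R).
have kap'0 : 0 < kap' by rewrite divr_gt0.
have e'0 : 0 < e' by rewrite divr_gt0// mulr_gt0.
pose x := kap' * al ^+ 2; pose y := kap' * (1 - al) ^+ 2.
have x0 : 0 <= x by rewrite mulr_ge0 ?sqr_ge0// ltW.
have y0 : 0 <= y by rewrite mulr_ge0 ?sqr_ge0// ltW.
have yx : y <= x.
  by rewrite ler_wpM2l ?(ltW kap'0)// lerXn2r ?nnegrE ?(ltW al0)//; lra.
have [M hM] := truncn_bound_nat x0.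
have [d d0 [N hN]] := lp_lower_dir (K.+1 * M)%N X0 al0 al1 kap'0 good e'0.
have [N1 hN1] := truncn_near x0 d0; have [N2 hN2] := truncn_near y0 d0.
exists (maxn N (maxn N1 N2)) => n; rewrite !geq_max => /andP[n1 /andP[n2 n3]].
pose a := Num.truncn (n%:R * x); pose b := Num.truncn (n%:R * y).
have ba : (b <= a)%N by rewrite le_truncn// ler_wpM2l.
have aM : (a <= M * n)%N := hM n.
have fits (z : R) : 0 <= z ->
    (K.+1 * Num.truncn (n%:R * (z / K.+1%:R)) <= Num.truncn (n%:R * z))%N.
  move=> z0; rewrite truncn_ge_nat ?mulr_ge0// natrM.
  apply: (@le_trans _ _ (K.+1%:R * (n%:R * (z / K.+1%:R)))).
    by rewrite ler_pM2l// truncn_le mulr_ge0// divr_ge0.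
  by rewrite le_eqVlt; apply/orP; left; apply/eqP; field.
have := @lp_chain _ w (c^-1 * ((kap' - e') * n%:R)) a b K w0.
have blocks k : (k < K)%N -> c^-1 * ((kap' - e') * n%:R) <= lp (sh (k.+1 * a) (k * b) w) a b.
  move=> kK.
  have lim m : (m <= a)%N -> (m <= K.+1 * M * n)%N.
    by move=> ma; rewrite -mulnA (leq_trans ma)// (leq_trans aM)// leq_pmull.
  have lim2 l m : (l <= K.+1)%N -> (m <= a)%N -> (l * m <= K.+1 * M * n)%N.
    by move=> lK ma; rewrite -mulnA leq_mul// (leq_trans ma).
  apply: (@le_trans _ _ (c^-1 * lp (sh (k.+1 * a) (k * b) X) a b)).
    rewrite ler_pM2l ?invr_gt0//.
    apply: (hN n n1 _ _ _ _ _ _ (lim a (leqnn a)) (lim b ba) (hN1 n n2) (hN2 n n3)).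
      by apply: lim2 => //; exact: ltnW.
    by apply: lim2 => //; rewrite ltnW// ltnW.
  rewrite -lpZ ?invr_ge0 ?(ltW c0)//; apply: le_lpw => i j ia jb; rewrite /sh Xw//.
  (* Block [k] lies to the right of [k.+1 * a] and below [k.+1 * b], and [b <= a], so all its cells
     satisfy [j <= i]. *)
  apply: leq_trans (leq_addr _ _); apply: ltnW.
  rewrite mulSnr; apply: (@leq_trans (k * b + b)); first by rewrite ltn_add2l.
  by rewrite leq_add// leq_mul2l ba orbT.
move=> /(_ blocks) H; apply: le_trans (le_trans H _); last first.
  apply: le_lp => //.
  - rewrite /a /x; have -> : kap' * al ^+ 2 = kap * al ^+ 2 / K.+1%:R by rewrite /kap' mulrAC.
    by apply: fits; rewrite mulr_ge0 ?sqr_ge0// ltW.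
  - rewrite /b /y; have -> : kap' * (1 - al) ^+ 2 = kap * (1 - al) ^+ 2 / K.+1%:R.
      by rewrite /kap' mulrAC.
    apply: leq_trans (fits _ _); first by rewrite leq_mul2r leqnSn orbT.
    by rewrite mulr_ge0 ?sqr_ge0// ltW.
have -> : c^-1 * ((kap' - e') * n%:R) * K%:R = c^-1 * ((kap' - e') * K%:R) * n%:R by ring.
rewrite ler_wpM2r//.
have KE : K%:R = K.+1%:R - 1 :> R by rewrite -natr1 addrK.
have -> : c^-1 * kap - e = c^-1 * (kap - c * e) by field; rewrite gt_eqF.
rewrite ler_pM2l ?invr_gt0//.
have k1 : kap' * K%:R = kap - kap' by rewrite KE /kap'; field.
have k2 : e' * K%:R = c * e / 2 - e' by rewrite KE /e'; field.
have k3 : kap' <= c * e / 2.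
  rewrite /kap' ler_pdivrMr//; move: hK; rewrite ler_pdivrMr//; lra.
rewrite mulrBl k1 k2; lra.
Qed.

Lemma box_upper (R : realType) (X w : nat -> nat -> R) (al c x y : R) :
  (forall i j, 0 <= X i j) -> 0 < al -> al < 1 -> bw_good X al -> 0 < c ->
  0 <= x -> 0 <= y -> (forall i j, w i j <= c^-1 * X i j) ->
  ev_le (box w x y) (c^-1 * (x / al + y / (1 - al))).
Proof.
move=> X0 al0 al1 good c0 x0 y0 wX e e0; have al10 : 0 < 1 - al by lra.
have ce0 : 0 < c * e by rewrite mulr_gt0.
have [M1 hM1] := truncn_bound_nat x0; have [M2 hM2] := truncn_bound_nat y0.
have [N hN] := lp_upper (maxn M1 M2) X0 al0 al1 good ce0.
exists N => n nN; set a := Num.truncn (n%:R * x); set b := Num.truncn (n%:R * y).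
have aM : (a <= maxn M1 M2 * n)%N.
  by apply: (leq_trans (hM1 n)); rewrite leq_mul2r leq_maxl orbT.
have bM : (b <= maxn M1 M2 * n)%N.
  by apply: (leq_trans (hM2 n)); rewrite leq_mul2r leq_maxr orbT.
have := hN n nN 0%N 0%N a b isT isT aM bM => H.
apply: (@le_trans _ _ (c^-1 * lp X a b)).
  by rewrite -lpZ ?invr_ge0 ?(ltW c0)//; apply: le_lpw => i j _ _; exact: wX.
have -> : (c^-1 * (x / al + y / (1 - al)) + e) * n%:R =
    c^-1 * (n%:R * x / al + n%:R * y / (1 - al) + c * e * n%:R).
  by field; rewrite !gt_eqF.
rewrite ler_pM2l ?invr_gt0//; apply: (le_trans H); rewrite lerD2r.
by apply: lerD; rewrite ler_pM2r ?invr_gt0// truncn_le mulr_ge0.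
Qed.

(* The last condition on [al] makes it unprofitable, to first order, to follow the diagonal. *)
Lemma box_upper_diag (R : realType) (X w : nat -> nat -> R) (al c1 c2 x y : R) :
  (forall i j, 0 <= X i j) -> (forall i j, 0 <= w i j) ->
  0 < al -> al < 1 -> bw_good X al -> bw_good X 2^-1 -> 0 < c2 -> c2 <= c1 ->
  0 <= x -> x <= y -> (forall i j, w i j <= c2^-1 * X i j) ->
  (forall i j, (i < j)%N -> w i j = c1^-1 * X i j) ->
  4 * (c1 / c2) <= al^-1 + (1 - al)^-1 ->
  ev_le (box w x y) (c1^-1 * (x / al + y / (1 - al))).
Proof.
move=> X0 w0 al0 al1 good goodh c20 c21 x0 xy wX wE hal e e0.
have al10 : 0 < 1 - al by lra.
have c10 : 0 < c1 by exact: lt_le_trans c21.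
have y0 : 0 <= y by exact: le_trans xy.
have h0 : (0 : R) < 2^-1 by rewrite invr_gt0.
have h1 : (2^-1 : R) < 1 by rewrite invf_lt1// ltr1n.
pose C := c1^-1 + c2^-1.
have C0 : 0 < C by rewrite addr_gt0 ?invr_gt0.
pose e' := e / (2 * C).
have e'0 : 0 < e' by rewrite divr_gt0// mulr_gt0.
have [M hM] := truncn_bound_nat y0.
have [N1 hN1] := lp_upper M X0 al0 al1 good e'0.
have [N2 hN2] := lp_upper M X0 h0 h1 goodh e'0.
(* The extra column of the upper block costs at most [c1^-1 / al]; from here on that is half of
   [e * n], and the choice of [e'] spends the other half. *)
exists (maxn (Num.truncn (2 * (c1^-1 / al) / e)).+1 (maxn N1 N2)) => n.
rewrite !geq_max => /andP[n3 /andP[n1 n2]].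
have nbig : 2 * (c1^-1 / al) <= n%:R * e.
  by rewrite -ler_pdivrMr//; apply: (le_trans (ltW (truncnS_gt _))); rewrite ler_nat.
rewrite /box; set m := Num.truncn (n%:R * x); set n' := Num.truncn (n%:R * y).
have mn : (m <= n')%N by rewrite le_truncn// ler_wpM2l.
have n'M : (n' <= M * n)%N := hM n.
have u0 i j : 0 <= c1^-1 * X i j by rewrite mulr_ge0 ?invr_ge0 ?(ltW c10).
have [k km H] := lp_last_diagonal w0 u0 wE mn.
apply: (le_trans H).
have km1 : (k.-1 <= m)%N := leq_trans (leq_pred k) km.
have kn : (k <= n')%N := leq_trans km mn.
have lim j : (j <= n')%N -> (j <= M * n)%N by move=> h; exact: leq_trans n'M.
have A1 : lp w k k <= c2^-1 * (4 * k%:R + e' * n%:R).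
  apply: (@le_trans _ _ (c2^-1 * lp X k k)).
    by rewrite -lpZ ?invr_ge0 ?(ltW c20)//; apply: le_lpw => i j _ _; exact: wX.
  rewrite ler_pM2l ?invr_gt0//.
  apply: (le_trans (hN2 n n2 0%N 0%N k k isT isT (lim _ kn) (lim _ kn))).
  by rewrite le_eqVlt; apply/orP; left; apply/eqP; field.
have A2 : lp (sh k.-1 k (fun i j => c1^-1 * X i j)) (m - k.-1) (n' - k) <=
    c1^-1 * ((m - k.-1)%:R / al + (n' - k)%:R / (1 - al) + e' * n%:R).
  rewrite (lpZ (sh k.-1 k X)) ?invr_ge0 ?(ltW c10)// ler_pM2l ?invr_gt0//.
  apply: hN1 => //; apply: lim; rewrite ?leq_subr//.
  - exact: leq_trans mn.
  - by rewrite (leq_trans (leq_subr _ _)).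
have kR : (m - k.-1)%:R <= m%:R - k%:R + 1 :> R.
  rewrite natrB// lerBlDr -addrA [1 + _]addrC natr1 -addrA lerDl.
  by rewrite addrC subr_ge0 ler_nat; case: (k).
have kR2 : (n' - k)%:R = n'%:R - k%:R :> R by rewrite natrB.
have mx : m%:R <= n%:R * x by rewrite truncn_le mulr_ge0.
have ny : n'%:R <= n%:R * y by rewrite truncn_le mulr_ge0.
have B1 : (m - k.-1)%:R / al <= n%:R * x / al - k%:R / al + al^-1.
  apply: (@le_trans _ _ ((n%:R * x - k%:R + 1) / al)).
    by rewrite ler_pM2r ?invr_gt0//; lra.
  by rewrite !mulrDl mulNr mul1r.
have B2 : (n' - k)%:R / (1 - al) <= n%:R * y / (1 - al) - k%:R / (1 - al).
  by rewrite kR2 -mulrBl ler_pM2r ?invr_gt0//; lra.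
(* The diagonal stretch is worth no more than its price under the linear functional of [al], so the
   terms in [k] cancel in the total. *)
have B3 : c2^-1 * (4 * k%:R) <= c1^-1 * (k%:R / al + k%:R / (1 - al)).
  have -> : c2^-1 * (4 * k%:R) = c1^-1 * (k%:R * (4 * (c1 / c2))).
    by field; rewrite !gt_eqF.
  by rewrite ler_pM2l ?invr_gt0// -mulrDr ler_wpM2l.
have B4 : c1^-1 * ((m - k.-1)%:R / al + (n' - k)%:R / (1 - al) + e' * n%:R) <=
  c1^-1 * (n%:R * x / al - k%:R / al + al^-1 +
    (n%:R * y / (1 - al) - k%:R / (1 - al)) + e' * n%:R).
  by rewrite ler_pM2l ?invr_gt0// lerD2r lerD.
have e'E : c1^-1 * (e' * n%:R) + c2^-1 * (e' * n%:R) = n%:R * e / 2.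
  by rewrite -mulrDl -/C /e'; field; rewrite gt_eqF.
have -> : (c1^-1 * (x / al + y / (1 - al)) + e) * n%:R =
  c1^-1 * (n%:R * x / al + n%:R * y / (1 - al)) + n%:R * e by ring.
move: A1 A2 B3 B4; rewrite !mulrDr !mulrN; lra.
Qed.

(** The leg up to [(s, s)] is [box_lower_diag] with parameter 1/2 and constant 4s, since 4s (1/2)^2
    = s. On the second leg every weight is at least [c1^-1 * X], whatever side of the diagonal it is
    on. *)
Lemma box_lower_mid (R : realType) (X w : nat -> nat -> R) (al kap s c1 c2 : R) :
  (forall i j, 0 <= X i j) -> (forall i j, 0 <= w i j) ->
  0 < al -> al < 1 -> 0 < kap -> 0 < s -> nearby_good X al -> nearby_good X 2^-1 ->
  0 < c1 -> 0 < c2 -> (forall i j, (j <= i)%N -> c2^-1 * X i j <= w i j) ->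
  (forall i j, c1^-1 * X i j <= w i j) ->
  ev_ge (box w (s + kap * al ^+ 2) (s + kap * (1 - al) ^+ 2)) (c2^-1 * (4 * s) + c1^-1 * kap).
Proof.
move=> X0 w0 al0 al1 kap0 s0 good goodh c10 c20 Xw2 Xw1 e e0.
have h0 : (0 : R) < 2^-1 by rewrite invr_gt0.
have h1 : (2^-1 : R) < 1 by rewrite invf_lt1// ltr1n.
have s40 : 0 < 4 * s by rewrite mulr_gt0.
have e20 : 0 < e / 2 by rewrite divr_gt0.
have hh : 1 - 2^-1 = 2^-1 :> R by field.
have hh' : 1 - 2^-1 <= 2^-1 :> R by rewrite hh.
have diag := box_lower_diag X0 w0 h0 h1 s40 goodh c20 Xw2 hh'.
have [N1 hN1] := diag _ e20.
have ce0 : 0 < c1 * (e / 2) by rewrite mulr_gt0.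
set x := s + _; set y := s + _.
have sx : s <= x by rewrite lerDl mulr_ge0 ?sqr_ge0// ltW.
have sy : s <= y by rewrite lerDl mulr_ge0 ?sqr_ge0// ltW.
have x0 : 0 <= x by lra.
have y0 : 0 <= y by lra.
have [M1 hM1] := truncn_bound_nat x0; have [M2 hM2] := truncn_bound_nat y0.
have [d d0 [N2 hN2]] := lp_lower_dir (maxn M1 M2) X0 al0 al1 kap0 good ce0.
have d20 : 0 < d / 2 by rewrite divr_gt0.
have [N3 hN3] := truncn_near x0 d20; have [N4 hN4] := truncn_near y0 d20.
have [N5 hN5] := truncn_near (ltW s0) d20.
exists (maxn (maxn N1 N2) (maxn N3 (maxn N4 N5))) => n.
rewrite !geq_max => /andP[/andP[n1 n2] /andP[n3 /andP[n4 n5]]].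
have := hN1 n n1; have := hN3 n n3; have := hN4 n n4; have := hN5 n n5.
rewrite /box hh; have -> : 4 * s * 2^-1 ^+ 2 = s by field.
set p := Num.truncn (n%:R * s); set m := Num.truncn (n%:R * x).
set m' := Num.truncn (n%:R * y).
move=> nears neary nearx low.
have pm : (p <= m)%N by rewrite le_truncn// ler_wpM2l.
have pm' : (p <= m')%N by rewrite le_truncn// ler_wpM2l.
have mM : (m <= maxn M1 M2 * n)%N.
  by apply: (leq_trans (hM1 n)); rewrite leq_mul2r leq_maxl orbT.
have m'M : (m' <= maxn M1 M2 * n)%N.
  by apply: (leq_trans (hM2 n)); rewrite leq_mul2r leq_maxr orbT.
have pM : (p <= maxn M1 M2 * n)%N := leq_trans pm mM.
have Hx : `|(m - p)%:R - kap * al ^+ 2 * n%:R| <= d * n%:R.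
  rewrite natrB//; move: nears nearx; rewrite !ler_norml /x => /andP[s1 s2] /andP[t1 t2].
  by clear -s1 s2 t1 t2; apply/andP; split; lra.
have Hy : `|(m' - p)%:R - kap * (1 - al) ^+ 2 * n%:R| <= d * n%:R.
  rewrite natrB//; move: nears neary; rewrite !ler_norml /y => /andP[s1 s2] /andP[t1 t2].
  by clear -s1 s2 t1 t2; apply/andP; split; lra.
have H := hN2 n n2 p p (m - p)%N (m' - p)%N pM pM (leq_trans (leq_subr _ _) mM)
  (leq_trans (leq_subr _ _) m'M) Hx Hy.
have cat := lp_cat p p (m - p)%N (m' - p)%N w0.
rewrite !subnKC// in cat; apply: le_trans cat.
have H2 : c1^-1 * ((kap - c1 * (e / 2)) * n%:R) <= lp (sh p p w) (m - p) (m' - p).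
  apply: (@le_trans _ _ (c1^-1 * lp (sh p p X) (m - p) (m' - p))).
    by rewrite ler_pM2l ?invr_gt0.
  by rewrite -lpZ ?invr_ge0 ?(ltW c10)//; apply: le_lpw => i j _ _; exact: Xw1.
have E : c1^-1 * ((kap - c1 * (e / 2)) * n%:R) = c1^-1 * kap * n%:R - e / 2 * n%:R.
  by field; rewrite gt_eqF.
clear -low H2 E; lra.
Qed.

(** * Lattice paths and the recursion *)

Lemma path_sum_le_lp (R : realType) (f : nat * nat -> R) (p : seq (nat * nat)) :
  (forall i j, 0 <= f (i.+1, j.+1)) -> path lpp_step (1, 1)%N p ->
  [/\ (0 < (last (1, 1)%N p).1)%N, (0 < (last (1, 1)%N p).2)%N &
    \sum_(v <- (1, 1)%N :: p) f v <=
    lp (fun i j => f (i.+1, j.+1)) (last (1, 1)%N p).1 (last (1, 1)%N p).2].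
Proof.
move=> f0; elim/last_ind: p => [_|p v ih].
  by split=> //; rewrite big_seq1 /= !maxxx add0r.
rewrite rcons_path last_rcons => /andP[/ih[m0 n0 le]].
rewrite -rcons_cons -cats1 big_cat big_seq1 /=.
case: (last _ p) m0 n0 le => -[|m] [|n] //= _ _ le.
by case/orP => /eqP -> /=; split=> //; rewrite -/(lp _ _ _) lerD2r le_max le ?orbT.
Qed.

Lemma lp_path_sum (R : realType) (f : nat * nat -> R) (a b : nat) :
  (forall i j, 0 <= f (i.+1, j.+1)) -> (0 < a)%N -> (0 < b)%N ->
  exists p, [/\ path lpp_step (1, 1)%N p, last (1, 1)%N p = (a, b) &
    \sum_(v <- (1, 1)%N :: p) f v = lp (fun i j => f (i.+1, j.+1)) a b].
Proof.
move=> f0; set w := fun i j => f (i.+1, j.+1).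
have w0 i j : 0 <= w i j by exact: f0.
pattern a, b; apply: lp_ind => {a b} // a b iha ihb _ _.
have ext (m n : nat) : lpp_step (m, n) (a.+1, b.+1) -> (exists p, [/\ path lpp_step (1, 1)%N p,
    last (1, 1)%N p = (m, n) & \sum_(v <- (1, 1)%N :: p) f v = lp w m n]) ->
    lp w a.+1 b.+1 = lp w m n + w a b ->
    exists p, [/\ path lpp_step (1, 1)%N p, last (1, 1)%N p = (a.+1, b.+1) &
      \sum_(v <- (1, 1)%N :: p) f v = lp w a.+1 b.+1].
  move=> st [p [pp pl ps]] E; exists (rcons p (a.+1, b.+1)).
  by rewrite rcons_path pp pl st last_rcons -rcons_cons -cats1 big_cat big_seq1 ps E.
have stepl : lpp_step (a, b.+1) (a.+1, b.+1) by rewrite /lpp_step /= eqxx.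
have stepu : lpp_step (a.+1, b) (a.+1, b.+1) by rewrite /lpp_step /= eqxx orbT.
case: a b => [|a] [|b] in iha ihb ext stepl stepu *.
- by exists [::]; rewrite big_seq1 /= !maxxx add0r.
- apply: ext stepu (ihb isT isT) _.
  by rewrite lpSS lp0n max_r// lp_ge0.
- apply: ext stepl (iha isT isT) _.
  by rewrite lpSS lpn0 max_l// lp_ge0.
have [h|h] := leP (lp w a.+2 b.+1) (lp w a.+1 b.+2).
  by apply: ext stepl (iha isT isT) _; rewrite [LHS]lpSS max_l.
by apply: ext stepu (ihb isT isT) _; rewrite [LHS]lpSS max_r// ltW.
Qed.

Lemma lpp_G_lp d (T : measurableType d) (R : realType) (P : probability T R)
    (Y : nat * nat -> {RV P >-> R}) (w : T) (m n : nat) :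
  (forall i j, 0 <= Y (i.+1, j.+1) w) -> (0 < m)%N -> (0 < n)%N ->
  lpp_G Y m n w = lp (fun i j => Y (i.+1, j.+1) w) m n.
Proof.
move=> Y0 m0 n0; rewrite /lpp_G; set S := [set _ | _ in _].
have ubS : ubound S (lp (fun i j => Y (i.+1, j.+1) w) m n).
  move=> _ [q [p [-> [pp pl]]] <-].
  by have := path_sum_le_lp (f := fun v => Y v w) Y0 pp; rewrite pl => -[].
have inS : S (lp (fun i j => Y (i.+1, j.+1) w) m n).
  have [p [pp pl ps]] := lp_path_sum (f := fun v => Y v w) Y0 m0 n0.
  by exists ((1, 1)%N :: p); first by exists p.
apply/eqP; rewrite eq_le; apply/andP; split.
  by apply: ge_sup => //; exists (lp (fun i j => Y (i.+1, j.+1) w) m n).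
by apply: ub_le_sup => //; exists (lp (fun i j => Y (i.+1, j.+1) w) m n).
Qed.

Lemma nearby_good_ae d (T : measurableType d) (R : realType) (P : probability T R)
    (X : nat * nat -> T -> R) (al : R) : 0 < al -> al < 1 ->
  (forall v w, 0 <= X v w) -> elaw_family P setT (fun=> 1) X ->
  {ae P, forall w, nearby_good (fun i j => X (i, j) w) al}.
Proof.
move=> al0 al1 X0 fam.
have cond (be : R) (C : Prop) : (C -> 0 < be /\ be < 1) ->
    {ae P, forall w, C -> bw_good (fun i j => X (i, j) w) be}.
  move=> h; have [c|nc] := pselect C; last by apply: aeW => w /nc.
  have [be0 be1] := h c.
  by apply: filterS (bw_good_ae be0 be1 X0 fam) => w gw _.
have g := bw_good_ae al0 al1 X0 fam.
have gm : {ae P, forall w, forall k : nat, 0 < al - k.+1%:R^-1 ->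
    bw_good (fun i j => X (i, j) w) (al - k.+1%:R^-1)}.
  apply/ae_foralln => k; apply: cond => h; split=> //.
  by rewrite ltrBlDr (lt_trans al1)// ltrDl invr_gt0.
have gp : {ae P, forall w, forall k : nat, al + k.+1%:R^-1 < 1 ->
    bw_good (fun i j => X (i, j) w) (al + k.+1%:R^-1)}.
  by apply/ae_foralln => k; apply: cond => h; split=> //; rewrite addr_gt0// invr_gt0.
near=> w; split; near: w => //.
Unshelve. all: end_near. Qed.

(** * Parameters of the limit shape and the three regimes *)

Lemma elaw_lt0 (R : realType) (r : R) : 0 < r -> elaw r `]-oo, 0%R[%classic = 0%E.
Proof.
move=> r0; apply/eqP; rewrite eq_le elaw_ge0 andbT.
have <- : elaw r `]-oo, 0%R]%classic = 0%E.
  by rewrite elaw_le// mulr0 expR0 subee.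
apply: (@le_measure _ _ _ (elaw r)); rewrite ?inE//.
by move=> x /=; rewrite !in_itv /= => /ltW.
Qed.

(** [lpp_b] is the smaller root of (1 + b)^2 = 4cb; the two roots have product 1, so it lies in (0,
    1]. *)
Lemma lpp_b_prop (R : realType) (c1 c2 : R) : 0 < c2 -> c2 <= c1 ->
  [/\ 0 < lpp_b c1 c2, lpp_b c1 c2 <= 1 &
      (1 + lpp_b c1 c2) ^+ 2 = 4 * (c1 / c2) * lpp_b c1 c2].
Proof.
move=> c20 c21; rewrite /lpp_b; set c := c1 / c2.
have c1' : 1 <= c by rewrite ler_pdivlMr// mul1r.
set r := Num.sqrt _.
have r0 : 0 <= r by exact: sqrtr_ge0.
have r2 : r ^+ 2 = c * (c - 1) by rewrite sqr_sqrtr// mulr_ge0; lra.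
have rlo : c - 1 <= r.
  rewrite -(@ler_pXn2r _ 2) ?nnegrE//; last lra.
  by rewrite r2 expr2 ler_wpM2r; lra.
have rhi : 2 * r < 2 * c - 1.
  rewrite -(@ltr_pXn2r _ 2) ?nnegrE ?mulr_ge0//; last lra.
  by rewrite exprMn r2; lra.
split; [lra|lra|].
have -> : (1 + (2 * c - 1 - 2 * r)) ^+ 2 = 4 * c ^+ 2 - 8 * c * r + 4 * r ^+ 2 by ring.
rewrite r2; ring.
Qed.

Lemma lpp_family d (T : measurableType d) (R : realType) (P : probability T R)
    (c1 c2 : R) (Y : nat * nat -> {RV P >-> R}) :
  0 < c2 -> c2 <= c1 -> mutually_independent site Y ->
  (forall v, site v -> forall A : set R, measurable A ->
     distribution P (Y v) A = exponential_prob (lpp_rate c1 c2 v) A) ->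
  elaw_family P site (lpp_rate c1 c2) (fun v => Y v).
Proof.
move=> c20 c21 ind law; have c10 : 0 < c1 by exact: lt_le_trans c21.
have rpos v : 0 < lpp_rate c1 c2 v.
  by rewrite /lpp_rate; case: ifP => // _; case: ifP => // _; rewrite lt_min c10.
split=> [v _|v _|s A us sD mA]; [exact: rpos|exact: measurable_funPT|].
have := ind s us sD A (fun v _ => mA v).
rewrite (_ : \bigcap_(i in _) _ = [set w | forall i, i \in s -> A i (Y i w)])// => ->.
apply: eq_big_seq => v vs; rewrite elawE// -law//; exact: sD.
Qed.

(** [al] minimizes x/al + y/(1 - al), and the minimum [kap] is the limit shape of the model with
    rate 1. *)
Lemma sqrt_direction (R : realType) (x y : R) : 0 < x -> 0 < y ->
  let al := Num.sqrt x / (Num.sqrt x + Num.sqrt y) in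
  let kap := (Num.sqrt x + Num.sqrt y) ^+ 2 in
  [/\ 0 < al, al < 1, kap * al ^+ 2 = x, kap * (1 - al) ^+ 2 = y &
      x / al + y / (1 - al) = kap].
Proof.
move=> x0 y0 al kap; rewrite /al /kap.
have sx0 : 0 < Num.sqrt x by rewrite sqrtr_gt0.
have sy0 : 0 < Num.sqrt y by rewrite sqrtr_gt0.
have sxE : x = Num.sqrt x ^+ 2 by rewrite sqr_sqrtr// ltW.
have syE : y = Num.sqrt y ^+ 2 by rewrite sqr_sqrtr// ltW.
set p := Num.sqrt x in sx0 sxE *; set q := Num.sqrt y in sy0 syE *.
have pq0 : 0 < p + q by rewrite addr_gt0.
have -> : 1 - p / (p + q) = q / (p + q) by field; rewrite gt_eqF.
split; rewrite ?sxE ?syE.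
- by rewrite divr_gt0.
- by rewrite ltr_pdivrMr// mul1r ltrDl.
- by field; rewrite gt_eqF.
- by field; rewrite gt_eqF.
- by field; rewrite !gt_eqF.
Qed.

Unset Implicit Arguments. Set Strict Implicit. Set Printing Implicit Defensive.

Theorem mainTheorem1 (R : realType) (d : measure_display) (T : measurableType d)
  (P : probability T R) (c1 c2 : R) (Y : nat * nat -> {RV P >-> R}) :
  0 < c2 -> c2 <= c1 ->
  mutually_independent site Y ->
  (forall v, site v -> forall A : set R, measurable A ->
     distribution P (Y v) A = exponential_prob (lpp_rate c1 c2 v) A) ->
  forall x y : R, 0 < x -> 0 < y ->
  {ae P, forall w,
     (fun n : nat => (n%:R)^-1 *
        lpp_G Y (Num.truncn (n%:R * x)) (Num.truncn (n%:R * y)) w)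
       @ \oo --> lpp_Phi c1 c2 x y}.
Proof.
move=> c20 c21 ind law x y x0 y0; have c10 : 0 < c1 by exact: lt_le_trans c21.
have famY := lpp_family c20 c21 ind law.
have rpos v : 0 < lpp_rate c1 c2 v.
  by rewrite /lpp_rate; case: ifP => // _; case: ifP => // _; rewrite lt_min c10.
pose h (v : nat * nat) := (v.1.+1, v.2.+1).
have hI : injective h by move=> [i j] [i' j'] [-> ->].
(* The law makes [Y] nonnegative only almost surely. The positive part gives [X] this property
   everywhere, and it disappears again on the event [Y0ae]. *)
pose X v w : R := lpp_rate c1 c2 (h v) * Num.max (Y (h v) w) 0.
have famX : elaw_family P setT (fun=> 1) X.
  have f1 := @elaw_family_comp _ _ _ _ _ _ _ setT _ _ h famY hI (fun _ _ => conj isT isT).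
  have := elaw_family_scale f1 (fun v _ => rpos (h v)).
  congr elaw_family; apply/funext => v; by rewrite /= divff// gt_eqF.
have X0 v w : 0 <= X v w by rewrite mulr_ge0 ?(ltW (rpos _))// le_max lexx orbT.
have Y0ae : {ae P, forall w, forall i j : nat, 0 <= Y (i.+1, j.+1) w}.
  apply/ae_foralln => i; apply/ae_foralln => j.
  exists (Y (i.+1, j.+1) @^-1` `]-oo, 0%R[); split.
  - exact: measurable_funPTI.
  - have := elaw_family_law famY (conj isT isT : site (i.+1, j.+1)) (measurable_itv `]-oo, 0%R[).
    by rewrite elaw_lt0.
  - by move=> w /= /negP; rewrite -ltNge in_itv /=.
have good al : 0 < al -> al < 1 -> {ae P, forall w, nearby_good (fun i j => X (i, j) w) al}.
  by move=> al0 al1; exact: nearby_good_ae.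
have [al0 al1 alx aly alk] := sqrt_direction x0 y0.
set al := Num.sqrt x / _ in al0 al1 alx aly alk.
set kap := (Num.sqrt x + Num.sqrt y) ^+ 2 in alx aly alk.
have h0 : (0 : R) < 2^-1 by rewrite invr_gt0.
have h1 : (2^-1 : R) < 1 by rewrite invf_lt1// ltr1n.
have [b0 b1 bE] := lpp_b_prop c20 c21.
set b := lpp_b c1 c2 in b0 b1 bE.
pose be := b / (1 + b).
have b10 : 0 < 1 + b by rewrite addr_gt0.
have be0 : 0 < be by rewrite divr_gt0.
have be1 : be < 1 by rewrite ltr_pdivrMr// mul1r ltrDr.
have kap0 : 0 < kap by rewrite exprn_gt0// addr_gt0 ?sqrtr_gt0.
near=> w.
have Yw : forall i j : nat, 0 <= Y (i.+1, j.+1) w by near: w.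
have goodh : nearby_good (fun i j => X (i, j) w) 2^-1 by near: w; exact: good.
have gooda : nearby_good (fun i j => X (i, j) w) al by near: w; exact: good.
have goodb : nearby_good (fun i j => X (i, j) w) be by near: w; exact: good.
pose Z i j : R := Y (i.+1, j.+1) w; pose Xw i j := X (i, j) w.
have Z0 i j : 0 <= Z i j by exact: Yw.
have Xw0 i j : 0 <= Xw i j by exact: X0.
(* As [c2 <= c1], the minimum on the diagonal is [c2]: the diagonal joins the region of heavier
   weights. *)
have rateE i j : lpp_rate c1 c2 (i.+1, j.+1) = if (i < j)%N then c1 else c2.
  rewrite /lpp_rate /= ltnS; case: ifP => // _; case: ifP => // _.
  exact/min_r.
have XZ i j : Xw i j = (if (i < j)%N then c1 else c2) * Z i j.
  by rewrite /Xw /X /h /= rateE max_l.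
have ZXup i j : (i < j)%N -> Z i j = c1^-1 * Xw i j.
  by move=> ij; rewrite XZ ij mulrA mulVf ?mul1r// gt_eqF.
have ZXlo i j : (j <= i)%N -> Z i j = c2^-1 * Xw i j.
  by move=> ij; rewrite XZ ltnNge ij mulrA mulVf ?mul1r// gt_eqF.
have cinv : c1^-1 <= c2^-1 by rewrite lef_pV2.
have ZX1 i j : c1^-1 * Xw i j <= Z i j.
  by have [/ZXup->//|/ZXlo->] := ltnP i j; rewrite ler_wpM2r.
have ZX2 i j : Z i j <= c2^-1 * Xw i j.
  by have [/ZXup->|/ZXlo->//] := ltnP i j; rewrite ler_wpM2r.
have ZXlo' i j : (j <= i)%N -> c2^-1 * Xw i j <= Z i j by move=> /ZXlo->.
(* There is no path to a point with a zero coordinate, so the identification starts once [n * x] and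
   [n * y] reach 1. *)
have GE : \forall n \near \oo, n%:R^-1 * box Z x y n =
    n%:R^-1 * lpp_G Y (Num.truncn (n%:R * x)) (Num.truncn (n%:R * y)) w.
  exists (maxn (Num.truncn x^-1).+1 (Num.truncn y^-1).+1) => // n /=.
  rewrite geq_max => /andP[nx ny].
  have pos (z : R) : 0 < z -> ((Num.truncn z^-1).+1 <= n)%N -> (0 < Num.truncn (n%:R * z))%N.
    move=> z0 nz; rewrite truncn_ge_nat ?mulr_ge0 ?(ltW z0)//.
    rewrite -ler_pdivrMr// mul1r; apply: (le_trans (ltW (truncnS_gt _))).
    by rewrite ler_nat.
  by rewrite lpp_G_lp// ?pos.
apply: (cvg_trans (near_eq_cvg GE)); rewrite /lpp_Phi -/b.
have [g1 _ _] := gooda; have [gh1 _ _] := goodh; have [gb1 _ _] := goodb.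
have goodhalf : bw_good Xw 2^-1 by exact: gh1.
case: ifPn => [xb|]; last rewrite -ltNge => bx.
  apply: ev_cvg.
    have := @box_lower _ Xw Z al kap c1 Xw0 al0 al1 kap0 gooda c10 ZX1.
    by rewrite alx aly.
  have xy : x <= y.
    apply: (le_trans xb); rewrite ler_piMl ?(ltW y0)//.
    by rewrite exprn_ile1// ltW.
  rewrite -/kap -alk; apply: (box_upper_diag (X := Xw) (c2 := c2)) => //; first exact: ltW.
  set p := Num.sqrt x; set q := Num.sqrt y.
  have p0 : 0 < p by rewrite sqrtr_gt0.
  have q0 : 0 < q by rewrite sqrtr_gt0.
  have pq : p <= b * q.
    rewrite -(@ler_pXn2r _ 2) ?nnegrE ?mulr_ge0 ?(ltW p0) ?(ltW q0) ?(ltW b0)//.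
    by rewrite exprMn !sqr_sqrtr ?(ltW x0) ?(ltW y0).
  have -> : al^-1 + (1 - al)^-1 = (p + q) ^+ 2 / (p * q).
    have -> : 1 - al = q / (p + q) by rewrite /al -/p -/q; field; rewrite gt_eqF ?addr_gt0.
    by rewrite /al -/p -/q; field; rewrite !gt_eqF ?addr_gt0.
  rewrite ler_pdivlMr ?mulr_gt0// -(ler_pM2r b0).
  have -> : 4 * (c1 / c2) * (p * q) * b = (1 + b) ^+ 2 * (p * q) by rewrite bE; ring.
  rewrite -subr_ge0.
  (* In the ratio p/q the quadratic vanishes at b and 1/b, so the condition on [al] holds when p <=
     b q, that is, x <= b^2 y. *)
  have -> : (p + q) ^+ 2 * b - (1 + b) ^+ 2 * (p * q) = (b * q - p) * (q - b * p) by ring.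
  apply: mulr_ge0; rewrite subr_ge0//.
  apply: (@le_trans _ _ p); first by rewrite ler_piMl ?(ltW p0).
  by apply: (le_trans pq); rewrite ler_piMl ?(ltW q0).
case: ifPn => [xy|]; last rewrite -leNgt => yx.
  (* For [b = 1] the middle regime is empty. *)
  have blt1 : b < 1.
    rewrite lt_neqAle b1 andbT; apply/eqP => bb.
    by move: bx; rewrite bb expr1n mul1r => /(lt_trans xy); rewrite ltxx.
  have b2 : 0 < 1 - b ^+ 2 by rewrite subr_gt0 exprn_ilt1// ltW.
  (* These solve (x, y) = (s, s) + kap2 (be^2, (1 - be)^2): a diagonal leg followed by one in the
     direction (b^2, 1). *)
  pose s := (x - b ^+ 2 * y) / (1 - b ^+ 2).
  pose kap2 := (1 + b) ^+ 2 * ((y - x) / (1 - b ^+ 2)).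
  have s0 : 0 < s by rewrite divr_gt0// subr_gt0.
  have kap20 : 0 < kap2 by rewrite mulr_gt0 ?exprn_gt0// divr_gt0// subr_gt0.
  have beV : 1 - be = (1 + b)^-1 by rewrite /be; field; rewrite gt_eqF.
  have b1n : 1 - b != 0 by rewrite gt_eqF// subr_gt0.
  have xE : s + kap2 * be ^+ 2 = x.
    by rewrite /s /kap2 /be; field; rewrite !gt_eqF.
  have yE : s + kap2 * (1 - be) ^+ 2 = y.
    by rewrite beV /s /kap2; field; rewrite !gt_eqF.
  have cE : 4 * (c1 / c2) = (1 + b) ^+ 2 / b by rewrite bE; field; rewrite !gt_eqF.
  have val : x * ((4 * (c1 / c2) - (1 + b) ^+ 2) / (c1 * (1 - b ^+ 2))) +
    y * (((1 + b) ^+ 2 - 4 * (c1 / c2) * b ^+ 2) / (c1 * (1 - b ^+ 2))) =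
    c1^-1 * (x / be + y / (1 - be)).
    rewrite beV cE /be; field; rewrite !gt_eqF//.
  rewrite val; apply: ev_cvg.
    have := @box_lower_mid _ Xw Z be kap2 s c1 c2 Xw0 Z0 be0 be1 kap20 s0 goodb goodh
      c10 c20 ZXlo' ZX1.
    rewrite xE yE; congr ev_ge.
    have -> : c2^-1 * (4 * s) = c1^-1 * (4 * (c1 / c2) * s) by field; rewrite !gt_eqF.
    rewrite cE beV /s /kap2 /be; field; rewrite !gt_eqF//.
  apply: (box_upper_diag (X := Xw) (c2 := c2)) => //; [exact: ltW|exact: ltW|].
  rewrite cE beV invrK /be invf_div le_eqVlt; apply/orP; left; apply/eqP.
  by field; rewrite gt_eqF.
(* For y <= x the segment to (x, y) stays in the region of rate [c2]; since no weight exceeds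
   [c2^-1 * X], the homogeneous upper bound matches. *)
have alh : 1 - al <= al.
  suff : y <= x -> (1 - al) ^+ 2 <= al ^+ 2.
    by move=> /(_ yx); rewrite ler_pXn2r ?nnegrE// ?subr_ge0 ltW.
  by rewrite -alx -aly ler_pM2l.
apply: ev_cvg.
  have := @box_lower_diag _ Xw Z al kap c2 Xw0 Z0 al0 al1 kap0 gooda c20 ZXlo' alh.
  by rewrite alx aly.
rewrite -/kap -alk; apply: (box_upper (X := Xw)) => //; exact: ltW.
Unshelve. all: end_near. Qed.
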